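(* Let $k\geq 2$ be an integer and let $G$ be a $1$-tough and $k$-connected $(P_2\cup kP_1)$-free graph. If $\mu_{k+1}(G)\geq\frac{7k-6}{5}$, then $G$ is hamiltonian or $G$ is (isomorphic to) the Petersen graph.
   Context: All graphs are finite and simple. $\omega(G)$ denotes the number of components of $G$, $d_G(x)$ the degree of $x$, and $dist_G(x,y)$ the length of a shortest path between $x$ and $y$ in $G$. For a real $t\geq 0$, $G$ is $t$-tough if $|S|\geq t\cdot\omega(G-S)$ for every vertex cut $S\subseteq V(G)$ (i.e. every $S$ such that $G-S$ is disconnected). A graph is hamiltonian if it contains a Hamiltonian cycle, i.e. a cycle containing every vertex. $P_2\cup kP_1$ is the graph consisting of one edge and $k$ isolated vertices (so $k+2$ vertices in total); $G$ is $H$-free if no induced subgraph of $G$ is isomorphic to $H$. For an integer $k$, a set $S\subseteq V(G)$ is a $k$-essential independent set of $G$ with center $x$ if $S$ is an independent set of $G$ with $|S|=k$, $x\in S$, and $dist_G(x,v)=2$ for all $v\in S\setminus\{x\}$. A $k$-essential independent set is one having some center. The essential independence number $\alpha_e(G)$ is the maximum integer $k$ such that $G$ contains a $k$-essential independent set. For an integer $k\geq 2$, let $\mathcal{S}_k$ be the set of all $k$-essential independent sets of $G$, and define $\mu_k(G):=\min\{\max_{x\in S}d_G(x): S\in\mathcal{S}_k\}$ if $\alpha_e(G)\geq k$, and $\mu_k(G):=+\infty$ otherwise. *)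

(* Defs.v *)
From HB Require Import structures.
From mathcomp Require Import all_boot all_order all_algebra.
From mathcomp Require Import constructive_ereal.
Set Implicit Arguments.
Unset Strict Implicit.
Unset Printing Implicit Defensive.
Import Order.TTheory GRing.Theory Num.Theory.

Record sgraph := SGraph {
  vertex :> finType;
  adj : rel vertex;
  adj_sym : symmetric adj;
  adj_irrefl : irreflexive adj }.

Arguments adj {s} x y.

Definition iso (G H : sgraph) : Prop :=
  exists2 f : G -> H, bijective f & {mono f : x y / adj x y}.

Section Induced.
Variables (G : sgraph) (W : {set G}).

Definition induced_adj : rel {x : G | x \in W} :=
  fun x y => adj (val x) (val y).

Lemma induced_sym : symmetric induced_adj.
Proof. by move=> x y; apply: adj_sym. Qed.

Lemma induced_irrefl : irreflexive induced_adj.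
Proof. by move=> x; apply: adj_irrefl. Qed.

Definition induced : sgraph := SGraph induced_sym induced_irrefl.

End Induced.

Definition induced_free (H G : sgraph) : Prop :=
  forall W : {set G}, ~ iso (induced W) H.

Definition delete (G : sgraph) (S : {set G}) : sgraph := induced (~: S).

Definition omega (G : sgraph) : nat := n_comp (@adj G) predT.

Definition connected (G : sgraph) : bool :=
  [forall x : G, forall y : G, connect adj x y].

Definition vertex_cut (G : sgraph) (S : {set G}) : bool :=
  ~~ connected (delete S).

Definition tough (R : realFieldType) (t : R) (G : sgraph) : Prop :=
  forall S : {set G}, vertex_cut S ->
    (t * (omega (delete S))%:R <= #|S|%:R)%R.

(* The bound [k < #|G|] makes the complete graph on n vertices k-connected
   exactly for k <= n - 1. *)
Definition kconnected (k : nat) (G : sgraph) : Prop :=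
  k < #|G| /\ forall S : {set G}, #|S| < k -> connected (delete S).

(* [size c > 2]: [ucycle] alone would also accept the closed walk x, y, x along
   a single edge. *)
Definition hamiltonian (G : sgraph) : Prop :=
  exists c : seq G, [/\ 2 < size c, ucycle adj c & forall x : G, x \in c].

(* The summand [bool] carries the edge, the summand ['I_k] the k isolated
   vertices. *)
Section P2kP1.
Variable k : nat.

Definition P2_kP1_adj : rel (bool + 'I_k) :=
  fun u v => if (u, v) is (inl a, inl b) then a != b else false.

Lemma P2_kP1_sym : symmetric P2_kP1_adj.
Proof. by move=> [[]|i] [[]|j]. Qed.

Lemma P2_kP1_irrefl : irreflexive P2_kP1_adj.
Proof. by move=> [[]|i]. Qed.

Definition P2_kP1 : sgraph := SGraph P2_kP1_sym P2_kP1_irrefl.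

End P2kP1.

(* The Petersen graph as the Kneser graph on the 2-subsets of a 5-set. *)
Definition petersen_adj : rel {A : {set 'I_5} | #|A| == 2} :=
  fun A B => [disjoint val A & val B].

Lemma petersen_sym : symmetric petersen_adj.
Proof. by move=> A B; apply: disjoint_sym. Qed.

Lemma petersen_irrefl : irreflexive petersen_adj.
Proof.
move=> A; apply: contraTF (valP A).
by rewrite /petersen_adj -setI_eq0 setIid => /eqP ->; rewrite cards0.
Qed.

Definition petersen : sgraph := SGraph petersen_sym petersen_irrefl.

Section Essential.
Variable G : sgraph.
Implicit Types (x y : G) (S : {set G}) (k : nat).

Definition deg x : nat := #|[set y | adj x y]|.

Definition has_path n x y : bool :=
  [exists p : n.-tuple G, [&& path adj x p, uniq (x :: p) & last x p == y]].

(* [None] when no path joins x and y; paths have fewer than [#|G|] edges. *)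
Definition dist x y : option nat :=
  ohead [seq n <- iota 0 #|G| | has_path n x y].

Definition independent S : bool :=
  [forall x in S, forall y in S, ~~ adj x y].

Definition essential_center k S x : bool :=
  [&& independent S, #|S| == k, x \in S
    & [forall v in S :\ x, dist x v == Some 2]].

Definition essential k S : bool := [exists x, essential_center k S x].

Definition alpha_e : nat :=
  \max_(k < #|G|.+1 | [exists S, essential k S]) k.

End Essential.

Definition mu (R : realFieldType) (k : nat) (G : sgraph) : \bar R :=
  if k <= alpha_e G then
    \big[Order.min/+oo%E]_(S : {set G} | essential k S)
      ((\max_(x in S) deg x)%:R%:E)%E
  else +oo%E.

(* Main.v *)
Require Import Defs.
From mathcomp Require Import all_boot all_order all_algebra.
From mathcomp Require Import constructive_ereal.
From mathcomp Require Import zify.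

(* Suppose that G is not hamiltonian. Take a longest cycle and a vertex x off it, of degree D
   maximal among the vertices missed by longest cycles. As G is (P2 + kP1)-free, an edge has fewer
   than k common non-neighbours in any independent set; together with k-connectedness, this makes
   the vertices off the cycle pairwise nonadjacent. The successors on the cycle of the neighbours
   of x are independent, as are the predecessors, and each of them is missed by a longest cycle.
   So x together with k successors is a (k+1)-essential independent set of vertices of degree at
   most D, whence 7k <= 5D + 6.

   If no successor is adjacent to a predecessor, then the vertices adjacent neither to x nor to any
   successor or predecessor are independent and more than half of all vertices, against toughness.
   Otherwise, counting the non-neighbours of cycle edges at the ends of an extremal chord between a
   successor and a predecessor gives 3D <= 4k - 4 if D > k, which is impossible, and D >= 3 if D = k.
   In the latter case 7k <= 5k + 6 leaves k = D = 3; all degrees near the cycle are then 3, and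
   the chords are forced to be those of a 9-cycle in the Petersen graph. *)

Set Implicit Arguments.
Unset Strict Implicit.
Unset Printing Implicit Defensive.
Import Order.TTheory GRing.Theory Num.Theory.

(** * Walks and edges *)

(** One estimate drives everything. For a cycle edge, collect the successors on one arc and the
    predecessors on the rest. A chord from the edge to a collected vertex tends to pair with a
    second chord into a longer cycle through [x], so the collected vertices and [x] are common
    non-neighbours of the edge; if independent, they number less than [k]. Only edges between
    successors and predecessors can spoil independence. Without them the estimate bounds what cycle
    edges see; with them, the shortage must be made up by successors or predecessors carrying such
    edges. For D > k, four shortages of about D - k sit on arcs going once around the cycle, whence
    4(D - k) + 4 <= D. This is a 4/3 bound on D/k, and the slope 7/5 of the hypothesis exceeds 4/3.
    For D = k the shortages still give three successors with such edges, so D >= 3, while 7k <= 5k +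
    6 means k <= 3: the constant 6 makes the threshold meet k exactly at the Petersen graph. *)

Section Graph.
Variable G : sgraph.
Implicit Types (u v w : G) (p q : seq G).

Definition walk u v p := exists p', [/\ p = u :: p', path adj u p' & last u p' = v].

Lemma walk1 u : walk u u [:: u].
Proof. by exists [::]. Qed.

Lemma walk_cat u v u' v' p q :
  walk u v p -> walk u' v' q -> adj v u' -> walk u v' (p ++ q).
Proof.
move=> [p' [-> pth <-]] [q' [-> pth' <-]] e; exists (p' ++ u' :: q'); split=> //.
  by rewrite cat_path pth /= e.
by rewrite last_cat.
Qed.

Lemma walk_cons u v w q : walk v w q -> adj u v -> walk u w (u :: q).
Proof. by move=> wq; apply: (walk_cat (walk1 u) wq). Qed.

Lemma walk_rev u v p : walk u v p -> walk v u (rev p).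
Proof.
move=> [p' [-> pth <-]]; exists (rev (belast u p')); split.
- by rewrite lastI rev_rcons.
- by rewrite (eq_path (e' := fun x y => adj y x)) ?rev_path // => x y; apply: adj_sym.
- by case: p' {pth} => //= a p'; rewrite rev_cons last_rcons.
Qed.

Lemma walk_cycle u v p : walk u v p -> adj v u -> cycle adj p.
Proof. by move=> [p' [-> pth <-]] e /=; rewrite rcons_path pth. Qed.

(** Otherwise [k] elements of [I] together with [u] and [v] would induce [P2_kP1 k]. Every use of
    freeness goes through this bound. *)
Lemma edge_cover k u v (I : {set G}) :
  induced_free (P2_kP1 k) G -> adj u v -> independent I ->
  {in I, forall w, ~~ adj u w && ~~ adj v w} -> #|I| < k.
Proof.
move=> fr e ind nI; rewrite ltnNge; apply/negP=> leI.
have [J sJ cJ] : exists2 J : {set G}, J \subset I & #|J| = k.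
  have := leI; rewrite -bin_gt0 -(cards_draws I k) => /card_gt0P [J].
  by rewrite inE => /andP [sJ /eqP cJ]; exists J.
have nJ w : w \in J -> ~~ adj u w && ~~ adj v w by move=> wJ; apply/nI/(subsetP sJ).
have indJ w w' : w \in J -> w' \in J -> ~~ adj w w'.
  move=> /(subsetP sJ) wI /(subsetP sJ) wI'.
  by move/forall_inP: ind => /(_ w wI) /forall_inP /(_ w' wI').
have nuJ : u \notin J by apply/negP=> /nJ; rewrite adj_irrefl adj_sym e.
have nvJ : v \notin J by apply/negP=> /nJ; rewrite e.
have nuv : u != v by apply: contraTneq e => ->; rewrite adj_irrefl.
pose W := u |: (v |: J).
have cW : #|W| = k.+2 by rewrite !cardsU1 cJ !inE negb_or nuv nuJ nvJ.
pose g0 (z : P2_kP1 k) : G := match z with inl b => if b then u else v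
  | inr i => enum_val (cast_ord (esym cJ) i) end.
have gJ i : g0 (inr i) \in J by apply: enum_valP.
have gW z : g0 z \in W.
  by case: z => [[]|i]; rewrite !inE ?eqxx ?orbT // gJ !orbT.
pose g z : induced W := Sub (g0 z) (gW z).
have g_inj : injective g.
  move=> z1 z2 /(congr1 val) /=; case: z1 z2 => [b1|i1] [b2|i2].
  - by case: b1 b2 => [] [] //= E; move: nuv; rewrite E eqxx.
  - by move=> E; have := gJ i2; rewrite -E; case: b1 {E} => /=; rewrite ?(negbTE nuJ) ?(negbTE nvJ).
  - by move=> E; have := gJ i1; rewrite E; case: b2 {E} => /=; rewrite ?(negbTE nuJ) ?(negbTE nvJ).
  - by move=> /enum_val_inj /cast_ord_inj ->.
have g_bij : bijective g.
  by apply: inj_card_bij => //; rewrite card_sig cW card_sum card_bool card_ord.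
have g_mono z1 z2 : adj (g z1) (g z2) = adj z1 z2.
  rewrite /adj /= /induced_adj /=; case: z1 z2 => [b1|i1] [b2|i2].
  - by case: b1 b2 => [] [] //=; rewrite ?adj_irrefl // adj_sym.
  - by have /andP[/negbTE A /negbTE B] := nJ _ (gJ i2); case: b1.
  - by have /andP[/negbTE A /negbTE B] := nJ _ (gJ i1); case: b2; rewrite adj_sym.
  - by apply/negbTE/indJ.
case: (g_bij) => f fK gK; apply: (fr W); exists f; first by exists g.
by move=> z1 z2; rewrite -[z1]gK -[z2]gK !fK g_mono.
Qed.
End Graph.

(** * A labelling of the Petersen graph *)

(* A labelling of the 2-subsets for which 0, ..., 8 is a cycle; 9 is the vertex off it. *)
Definition pet_label (i : nat) : nat * nat :=
  nth (0, 0) [:: (2, 3); (0, 4); (1, 3); (2, 4); (0, 3); (1, 2); (3, 4); (0, 2); (1, 4); (0, 1)] i.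

Definition pet_nbrs (i : nat) : seq nat :=
  nth [::] [:: [:: 8; 1; 9]; [:: 0; 2; 5]; [:: 1; 3; 7]; [:: 2; 4; 9]; [:: 3; 5; 8];
     [:: 4; 6; 1]; [:: 5; 7; 9]; [:: 6; 8; 2]; [:: 7; 0; 4]; [:: 0; 3; 6]] i.

Definition pet_set (i : nat) : {set 'I_5} :=
  [set inord (pet_label i).1; inord (pet_label i).2].

(** Claims about the ten labels become a closed boolean on natural numbers, proved by evaluation;
    [in_pet_set] and [inord5_eq] bring claims about sets into this form. *)
Lemma pet_check (Q : nat -> nat -> bool) :
  all (fun i => all (Q i) (iota 0 10)) (iota 0 10) -> forall i j : 'I_10, Q i j.
Proof.
by move=> /allP h i j; apply: (allP (h i _) j); rewrite mem_iota /= add0n ltn_ord.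
Qed.

Lemma pet_lt (i : 'I_10) : ((pet_label i).1 < 5) && ((pet_label i).2 < 5).
Proof. exact: (@pet_check (fun i _ => ((pet_label i).1 < 5) && ((pet_label i).2 < 5))). Qed.

Lemma inord5_eq a b : a < 5 -> b < 5 -> (inord a == inord b :> 'I_5) = (a == b).
Proof. by move=> a5 b5; rewrite -val_eqE /= !inordK. Qed.

Lemma in_pet_set a (j : 'I_10) : a < 5 ->
  (inord a \in pet_set j) = (a == (pet_label j).1) || (a == (pet_label j).2).
Proof. by move=> a5; have /andP[? ?] := pet_lt j; rewrite !inE !inord5_eq. Qed.

Lemma card_pet_set (i : 'I_10) : #|pet_set i| == 2.
Proof.
have /andP[l1 l2] := pet_lt i; rewrite cards2 inord5_eq //.
by rewrite (@pet_check (fun i _ => (pet_label i).1 != (pet_label i).2) _ i i).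
Qed.

Definition pet_vertex (i : 'I_10) : petersen := Sub (pet_set i) (card_pet_set i).

Lemma adj_pet_vertex i j : adj (pet_vertex i) (pet_vertex j) = ((j : nat) \in pet_nbrs i).
Proof.
have /andP[l1 l2] := pet_lt i; rewrite /adj /= /petersen_adj /=.
rewrite {1}/pet_set -setI_eq0 setIUl setU_eq0 !setI_eq0 !disjoints1.
rewrite !in_pet_set //; apply/eqP.
move: i j {l1 l2}; exact: (@pet_check (fun i j =>
  (~~ (((pet_label i).1 == (pet_label j).1) || ((pet_label i).1 == (pet_label j).2)) &&
   ~~ (((pet_label i).2 == (pet_label j).1) || ((pet_label i).2 == (pet_label j).2)))
  == (j \in pet_nbrs i))).
Qed.

Lemma pet_vertex_bij : bijective pet_vertex.
Proof.
apply: inj_card_bij => [i j /(congr1 val) /= E|].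
  have /andP[l1 l2] := pet_lt i.
  have : (inord (pet_label i).1 \in pet_set i) && (inord (pet_label i).2 \in pet_set i).
    by rewrite !inE !eqxx orbT.
  rewrite E !in_pet_set // => h; apply/val_inj/eqP; move: h; apply/implyP.
  move: i j {E l1 l2}.
  exact: (@pet_check (fun i j => ((((pet_label i).1 == (pet_label j).1) ||
    ((pet_label i).1 == (pet_label j).2)) && (((pet_label i).2 == (pet_label j).1) ||
    ((pet_label i).2 == (pet_label j).2))) ==> (i == j))).
by rewrite card_sig -cardsE card_draws !card_ord.
Qed.

Lemma iso_petersen (G : sgraph) (q : 'I_10 -> G) : injective q -> (forall v, exists i, v = q i) ->
  (forall i j, adj (q i) (q j) = ((j : nat) \in pet_nbrs i)) -> iso G petersen.
Proof.
move=> q_inj q_surj adjq.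
have q_bij : bijective q.
  apply: inj_card_bij => //; rewrite card_ord.
  have <- : #|codom q| = #|G| by apply: eq_card => v; have [i ->] := q_surj v; rewrite codom_f.
  by rewrite (leq_trans (card_size _)) // size_codom card_ord.
have [r qK rK] := q_bij; exists (pet_vertex \o r).
  by apply: bij_comp pet_vertex_bij _; exists q.
by move=> u v; rewrite -[u in RHS]rK -[v in RHS]rK adjq -adj_pet_vertex.
Qed.

Local Open Scope ring_scope.

(** * Longest cycles *)

Section Segments.
Variables (G : sgraph) (P : int -> G).

Definition seg (a b : int) : seq G := [seq P (a + i%:Z) | i <- iota 0 `|b - a|%N].

Lemma seg_cat a b c : a <= b -> b <= c -> seg a c = seg a b ++ seg b c.
Proof.
move=> ab bc; rewrite /seg.
have -> : `|c - a|%N = (`|b - a| + `|c - b|)%N by lia.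
rewrite iotaD map_cat add0n; congr cat.
rewrite -[`|b - a|%N in LHS]addn0 iotaDl -map_comp; apply: eq_map => i /=; congr P; lia.
Qed.

Lemma seg1 a : seg a (a + 1) = [:: P a].
Proof.
rewrite /seg (_ : absz (a + 1 - a)%R = 1%N) /= ?addr0 //; lia.
Qed.

Lemma mem_seg a b v : a <= b ->
  reflect (exists2 z, a <= z < b & v = P z) (v \in seg a b).
Proof.
move=> ab; apply: (iffP mapP) => [[i]|[z zab ->]].
  rewrite mem_iota => ib ->; exists (a + i%:Z) => //; lia.
by exists `|z - a|%N; [rewrite mem_iota; lia | congr P; lia].
Qed.

Lemma size_seg a b : size (seg a b) = `|b - a|%N.
Proof. by rewrite size_map size_iota. Qed.

Lemma walk_seg a b : (forall z, adj (P z) (P (z + 1))) ->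
  a < b -> walk (P a) (P (b - 1)) (seg a b).
Proof.
move=> Padj; elim: {b}_.+1 {-2}b (ltnSn `|b - a|) => // m IHm b bm ab.
have [->|ab1] := eqVneq b (a + 1); first by rewrite seg1 addrK; apply: walk1.
have -> : seg a b = seg a (b - 1) ++ [:: P (b - 1)].
  by rewrite -seg1 subrK; apply: seg_cat; lia.
apply: (walk_cat (IHm (b - 1) _ _) (walk1 _)); try lia.
by have := Padj (b - 1 - 1); rewrite subrK.
Qed.

Lemma walk_segE a b e : (forall z, adj (P z) (P (z + 1))) ->
  a < b -> b = e + 1 -> walk (P a) (P e) (seg a b).
Proof. by move=> ad ab be; have := walk_seg ad ab; rewrite be addrK. Qed.

End Segments.

(* A longest cycle, unrolled into a sequence of period n, so that its arcs become intervals
   of integers. *)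
Record lcycle (G : sgraph) (P : int -> G) (n : nat) : Prop := LCycle {
  lcycle_gt2 : (2 < n)%N;
  lcycle_period : forall z, P (z + n%:Z) = P z;
  lcycle_inj : forall z w, z <= w -> w < z + n%:Z -> P z = P w -> z = w;
  lcycle_adj : forall z, adj (P z) (P (z + 1));
  lcycle_max : forall c : seq G, ucycle adj c -> (2 < size c)%N -> (size c <= n)%N }.

Section LCycle.
Variables (G : sgraph) (n : nat).
Implicit Types (P : int -> G) (z w : int) (u v : G) (p q : seq G).

(** Reversing the cycle exchanges successors and predecessors; half of the later statements follow
    from their mirror images in this way. *)
Lemma lcycle_opp P : lcycle P n -> lcycle (fun z => P (- z)) n.
Proof.
case=> n3 per inj ad mx; split=> // [z|z w zw wz /esym E|z].
- by rewrite opprD -[in RHS](subrK n%:Z (- z)) per.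
- by have := inj _ _ _ _ E; lia.
- by rewrite adj_sym opprD; have := ad (- z - 1); rewrite subrK.
Qed.

Variables (P : int -> G) (lc : lcycle P n).
Let n3 := lcycle_gt2 lc.

Lemma lcycle_periodM z (t : int) : P (z + t * n%:Z) = P z.
Proof.
have pos (m : nat) y : P (y + m%:Z * n%:Z) = P y.
  elim: m y => [|m IHm] y; first by rewrite mul0r addr0.
  by rewrite -[m.+1]add1n PoszD mulrDl mul1r addrA IHm (lcycle_period lc).
case: (lerP 0 t) => t0; first by rewrite -[t]gez0_abs ?pos.
by rewrite -(pos `|t|%N) -addrA -mulrDl (_ : t + _ = 0) ?mul0r ?addr0 //; lia.
Qed.

Lemma lcycle_repr z a : exists t : int, a <= z + t * n%:Z < a + n%:Z.
Proof.
exists (- ((z - a) %/ n%:Z)%Z); have n0 : n%:Z != 0 by lia.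
have := divz_eq (z - a) n%:Z; have := modz_ge0 (z - a) n0.
by have := ltz_pmod (z - a) (_ : 0 < n%:Z); lia.
Qed.

Lemma lcycle_reprP z a : exists2 w, a <= w < a + n%:Z & forall e, P (w + e) = P (z + e).
Proof.
have [t ht] := lcycle_repr z a; exists (z + t * n%:Z) => // e.
by rewrite addrAC lcycle_periodM.
Qed.

Lemma uniq_seg a b : a <= b -> b <= a + n%:Z -> uniq (seg P a b).
Proof.
move=> ab bn; rewrite map_inj_in_uniq ?iota_uniq // => i j; rewrite !mem_iota => hi hj E.
have [ij|ij] := leqP i j.
  by have := lcycle_inj lc _ _ E; lia.
by have := lcycle_inj lc _ _ (esym E); lia.
Qed.

Lemma uniq_off a q : uniq q -> {in q, forall v z, P z != v} ->
  uniq (q ++ seg P a (a + n%:Z)).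
Proof.
move=> uq oq; rewrite cat_uniq uq uniq_seg ?andbT /=; try lia.
by apply/hasPn=> v /mem_seg [|z _ ->]; [lia | apply/negP=> /oq /(_ z); rewrite eqxx].
Qed.

(** A closed walk through exactly one period and the vertices of [q], all off the cycle, would be a
    longer cycle. Every rerouting that contradicts maximality ends here. *)
Lemma lcycle_absurd a q p u v : walk u v p -> adj v u ->
  uniq q -> {in q, forall v z, P z != v} -> (0 < size q)%N ->
  perm_eq p (q ++ seg P a (a + n%:Z)) -> False.
Proof.
move=> wp e uq oq q0 pp.
have sp : size p = (size q + n)%N.
  rewrite (perm_size pp) size_cat size_seg; congr addn; lia.
have p2 : (2 < size p)%N by have := lcycle_gt2 lc; lia.
have := lcycle_max lc (c := p).
by rewrite /ucycle (walk_cycle wp e) (perm_uniq pp) uniq_off // => /(_ isT p2) h; lia.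
Qed.

End LCycle.

(** Lists are permutations of each other when every predicate has equal counts on them; reversals
    and concatenations then reduce to linear arithmetic. *)
Ltac permute_segments :=
  let a := fresh in apply/permP => a; rewrite /= !(count_cat, count_rev) /=; lia.

Section Connectors.
Variables (G : sgraph) (n : nat) (P : int -> G) (lc : lcycle P n).
Variables (h h' : G) (q : seq G) (wq : walk h h' q) (uq : uniq q).
Hypothesis oq : {in q, forall v z, P z != v}.

Let q0 : (0 < size q)%N. Proof. by case: wq => q' [->]. Qed.
Let n3 := lcycle_gt2 lc.

Lemma detour_consecutive z : adj h (P z) -> adj h' (P (z + 1)) -> False.
Proof.
move=> hz hz'; apply: (lcycle_absurd lc (a := z + 1) _ _ uq oq q0 (perm_refl _)).
  apply: (walk_cat wq (walk_seg (lcycle_adj lc) _)) hz'; lia.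
by rewrite adj_sym (_ : z + 1 + n%:Z - 1 = z + n%:Z) ?(lcycle_period lc) //; lia.
Qed.

(** The longer cycle follows [q], runs from [P w] back to [P (z + 1)], takes the chord to
    [P (w + 1)] and runs on to [P z]. *)
Lemma detour_crossing z w : z < w < z + n%:Z ->
  adj h (P z) -> adj h' (P w) -> adj (P (z + 1)) (P (w + 1)) -> False.
Proof.
move=> zw hz hw e; have ad := lcycle_adj lc.
have w1 : walk (P w) (P (z + 1)) (rev (seg P (z + 1) (w + 1))).
  by apply: walk_rev; apply: walk_segE => //; lia.
have w2 : walk (P (w + 1)) (P (z + n%:Z)) (seg P (w + 1) (z + 1 + n%:Z)).
  by apply: walk_segE => //; lia.
apply: (lcycle_absurd lc (a := z + 1) (walk_cat wq (walk_cat w1 w2 e) hw) _ uq oq q0).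
  by rewrite (lcycle_period lc) adj_sym.
rewrite (@seg_cat _ _ (z + 1) (w + 1) (z + 1 + n%:Z)); try lia.
permute_segments.
Qed.

End Connectors.

(** * Reroutings of a longest cycle through a vertex off it *)

Record base (G : sgraph) (P : int -> G) (n : nat) (x : G) : Prop := Base {
  base_lcycle : lcycle P n;
  base_off : forall z, P z != x;
  base_out : forall u v, (forall z, P z != u) -> (forall z, P z != v) -> ~~ adj u v }.

Lemma base_opp (G : sgraph) (P : int -> G) n x : base P n x -> base (fun z => P (- z)) n x.
Proof.
case=> lc off out; split=> [|z|u v ou ov]; [exact: lcycle_opp | exact: off |].
by apply: out => z; [have := ou (- z) | have := ov (- z)]; rewrite opprK.
Qed.

Section Patterns.
Variables (G : sgraph) (n : nat) (x : G).
Section Fixed.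
Variables (P : int -> G) (bP : base P n x).
Let lc := base_lcycle bP.
Let n3 := lcycle_gt2 lc.
Let ad := lcycle_adj lc.

Lemma off_x : {in [:: x], forall v z, P z != v}.
Proof. by move=> v; rewrite inE => /eqP -> z; apply: (base_off bP). Qed.

Lemma base_absurd a p u v : walk u v p -> adj v u ->
  perm_eq p (x :: seg P a (a + n%:Z)) -> False.
Proof. by move=> w e pp; apply: (lcycle_absurd lc w e (q := [:: x]) _ off_x _ pp). Qed.

Lemma nbr_not_consecutive z : adj x (P z) -> ~~ adj x (P (z + 1)).
Proof.
by move=> e; apply/negP; apply: (detour_consecutive lc (walk1 x) _ off_x).
Qed.

Lemma succ_indep z w : adj x (P z) -> adj x (P w) -> ~~ adj (P (z + 1)) (P (w + 1)).
Proof.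
move=> ez ew; have [w' hw' E] := lcycle_reprP lc w z; rewrite -E.
have [->|zw'] := eqVneq w' z; first by rewrite adj_irrefl.
apply/negP; apply: (detour_crossing lc (walk1 x) _ off_x) => //; first lia.
by have := E 0; rewrite !addr0 => ->.
Qed.

(* [adj x (P (z - 1))] says that P z is the successor of a neighbour of x, and
   [adj x (P (z + 1))] that it is the predecessor of one. *)
Lemma crossing_succ_succ p q r : p + 2 <= q -> q < r -> r <= p + n%:Z ->
  adj x (P (q - 1)) -> adj x (P (r - 1)) ->
  adj (P p) (P q) -> adj (P (p + 1)) (P r) -> False.
Proof.
move=> pq qr rp aq ar eq er.
(* The longer cycle is [x], [P (r - 1)] down to [P q], [P p] down to [P r], [P (p + 1)] up to
   [P (q - 1)]. *)
have w1 : walk (P (r - 1)) (P q) (rev (seg P q r)).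
  by apply: walk_rev; apply: walk_segE => //; lia.
have w2 : walk (P (p + n%:Z)) (P r) (rev (seg P r (p + 1 + n%:Z))).
  by apply: walk_rev; apply: walk_segE => //; lia.
have w3 : walk (P (p + 1)) (P (q - 1)) (seg P (p + 1) q) by apply: walk_segE => //; lia.
rewrite adj_sym in er; rewrite -(lcycle_period lc p) adj_sym in eq.
apply: (base_absurd (a := p + 1) (walk_cons (walk_cat w1 (walk_cat w2 w3 er) eq) ar)).
  by rewrite adj_sym.
rewrite (@seg_cat _ _ (p + 1) q (p + 1 + n%:Z)); try lia.
rewrite (@seg_cat _ _ q r (p + 1 + n%:Z)); try lia.
permute_segments.
Qed.

(** The longer cycle is [x], [P (r + 1)] up to [P p], [P r] down to [P q], [P (p + 1)] up to
    [P (q - 1)]. *)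
Lemma crossing_pred_succ p q r : p + 2 <= q -> q <= r -> r <= p + n%:Z - 1 ->
  adj x (P (q - 1)) -> adj x (P (r + 1)) ->
  adj (P p) (P r) -> adj (P (p + 1)) (P q) -> False.
Proof.
move=> pq qr rp aq ar er eq.
have w1 : walk (P (r + 1)) (P (p + n%:Z)) (seg P (r + 1) (p + 1 + n%:Z)).
  by apply: walk_segE => //; lia.
have w2 : walk (P r) (P q) (rev (seg P q (r + 1))).
  by apply: walk_rev; apply: walk_segE => //; lia.
have w3 : walk (P (p + 1)) (P (q - 1)) (seg P (p + 1) q) by apply: walk_segE => //; lia.
rewrite adj_sym in eq; rewrite -(lcycle_period lc p) in er.
apply: (base_absurd (a := p + 1) (walk_cons (walk_cat w1 (walk_cat w2 w3 eq) er) ar)).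
  by rewrite adj_sym.
rewrite (@seg_cat _ _ (p + 1) q (p + 1 + n%:Z)); try lia.
rewrite (@seg_cat _ _ q (r + 1) (p + 1 + n%:Z)); try lia.
permute_segments.
Qed.

(** The chord from [P (f - 1)] ends before or after [h]; the two positions need different routes,
    each using all three chords. *)
Lemma crossing_three_chords f h i v : f < h -> h < i -> i < f + n%:Z - 1 ->
  f < v -> v <= i -> v != h ->
  adj x (P (i + 1)) -> adj x (P (v - 1)) ->
  adj (P h) (P f) -> adj (P (h - 1)) (P i) -> adj (P (f - 1)) (P v) -> False.
Proof.
move=> fh hi if_ fv vi vh ai av ehf ehi ev.
have w0 : walk (P (f - 1 + n%:Z)) (P (i + 1)) (rev (seg P (i + 1) (f + n%:Z))).
  by apply: walk_rev; apply: walk_segE => //; lia.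
rewrite adj_sym -(lcycle_period lc (f - 1)) in ev.
have [vlh|hlv] : v < h \/ h < v by lia.
- have w1 : walk (P (v - 1)) (P f) (rev (seg P f v)).
    by apply: walk_rev; apply: walk_segE => //; lia.
  have w2 : walk (P h) (P i) (seg P h (i + 1)) by apply: walk_segE => //; lia.
  have w3 : walk (P (h - 1)) (P v) (rev (seg P v h)).
    by apply: walk_rev; apply: walk_segE => //; lia.
  rewrite adj_sym in ehf; rewrite adj_sym in ehi.
  apply: (base_absurd (a := f)
    (walk_cons (walk_cat w1 (walk_cat w2 (walk_cat w3 w0 ev) ehi) ehf) av)).
    by rewrite adj_sym.
  rewrite (@seg_cat _ _ f v (f + n%:Z)); try lia.
  rewrite (@seg_cat _ _ v h (f + n%:Z)); try lia.
  rewrite (@seg_cat _ _ h (i + 1) (f + n%:Z)); try lia.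
  permute_segments.
- have w1 : walk (P (v - 1)) (P h) (rev (seg P h v)).
    by apply: walk_rev; apply: walk_segE => //; lia.
  have w2 : walk (P f) (P (h - 1)) (seg P f h) by apply: walk_segE => //; lia.
  have w3 : walk (P i) (P v) (rev (seg P v (i + 1))).
    by apply: walk_rev; apply: walk_segE => //; lia.
  apply: (base_absurd (a := f)
    (walk_cons (walk_cat w1 (walk_cat w2 (walk_cat w3 w0 ev) ehi) ehf) av)).
    by rewrite adj_sym.
  rewrite (@seg_cat _ _ f h (f + n%:Z)); try lia.
  rewrite (@seg_cat _ _ h v (f + n%:Z)); try lia.
  rewrite (@seg_cat _ _ v (i + 1) (f + n%:Z)); try lia.
  permute_segments.
Qed.

(** The cycle would absorb two vertices: [x], [P w] down to [P (z + 1)], [y], [P (w + 1)] up to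
    [P z]. *)
Lemma two_succ_out y z w : (forall z, P z != y) -> y != x -> z < w < z + n%:Z ->
  adj x (P z) -> adj x (P w) -> adj y (P (z + 1)) -> adj y (P (w + 1)) -> False.
Proof.
move=> oy yx zw az aw ez ew.
have w1 : walk (P w) (P (z + 1)) (rev (seg P (z + 1) (w + 1))).
  by apply: walk_rev; apply: walk_segE => //; lia.
have w2 : walk (P (w + 1)) (P (z + n%:Z)) (seg P (w + 1) (z + 1 + n%:Z)).
  by apply: walk_segE => //; lia.
rewrite adj_sym in ez.
apply: (@lcycle_absurd _ _ _ lc (z + 1) [:: x; y] _ _ _
  (walk_cons (walk_cat w1 (walk_cons w2 ew) ez) aw)) => //.
- by rewrite (lcycle_period lc) adj_sym.
- by rewrite /= inE andbT eq_sym.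
- by move=> v; rewrite !inE => /orP[] /eqP -> // z0; apply: (base_off bP).
- rewrite (@seg_cat _ _ (z + 1) (w + 1) (z + 1 + n%:Z)); try lia.
  permute_segments.
Qed.

End Fixed.

Lemma pred_indep P z w : base P n x ->
  adj x (P z) -> adj x (P w) -> ~~ adj (P (z - 1)) (P (w - 1)).
Proof.
move=> /base_opp bP az aw; have := @succ_indep _ bP (- z) (- w).
by rewrite /= !opprK => /(_ az aw); rewrite !opprD !opprK.
Qed.

(** Mirror image of [crossing_succ_succ]. The reversed edge starts at [- p - 1] and is moved back by
    one period, so that the positions come in the required order. *)
Lemma crossing_pred_pred P p q r : base P n x -> p < r -> r < q -> q <= p + n%:Z - 1 ->
  adj x (P (q + 1)) -> adj x (P (r + 1)) ->
  adj (P p) (P r) -> adj (P (p + 1)) (P q) -> False.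
Proof.
move=> bP pr rq qp aq ar er eq.
have per := lcycle_period (base_lcycle bP).
have e0 : P (- (- p - 1 - n%:Z)) = P (p + 1) by rewrite -(per (p + 1)); congr P; lia.
have e1 : P (- (- p - 1 - n%:Z + 1)) = P p by rewrite -(per p); congr P; lia.
have eN a b : a = - b -> P a = P (- b) by move=> ->.
apply: (crossing_succ_succ (base_opp bP) (p := - p - 1 - n%:Z) (q := - q) (r := - r)); rewrite ?e0 ?e1;
  try lia; try by rewrite opprK.
- by rewrite -(eN (q + 1)) //; lia.
- by rewrite -(eN (r + 1)) //; lia.
Qed.

End Patterns.

(** * Counting positions along the cycle *)

Section Count.
Implicit Types (B : int -> bool) (a b c e : int).

(** The range is half-open, from [a] included to [b] excluded; because of the absolute value it is
    meaningful only for [a <= b], as in [seg]. *)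
Definition cnt B a b : nat := count (fun i : nat => B (a + i%:Z)) (iota 0 `|b - a|%N).

Lemma cnt_cat B a b c : a <= b -> b <= c -> cnt B a c = (cnt B a b + cnt B b c)%N.
Proof.
move=> ab bc; rewrite /cnt.
have -> : `|c - a|%N = (`|b - a| + `|c - b|)%N by lia.
rewrite iotaD count_cat add0n; congr addn.
rewrite -[`|b - a|%N in LHS]addn0 iotaDl count_map; apply: eq_count => i /=; congr B; lia.
Qed.

Lemma cnt1 B a : cnt B a (a + 1) = B a :> nat.
Proof.
by rewrite /cnt (_ : absz (a + 1 - a)%R = 1%N) /= ?addr0 ?addn0 //; lia.
Qed.

Lemma cnt_id B a : cnt B a a = 0%N.
Proof. by rewrite /cnt subrr. Qed.

Lemma cnt_recl B a b : a < b -> cnt B a b = (B a + cnt B (a + 1)%R b)%N.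
Proof. by move=> ab; rewrite (@cnt_cat B a (a + 1)) ?cnt1; lia. Qed.

Lemma cnt_recr B a b : a <= b -> cnt B a (b + 1) = (cnt B a b + B b)%N.
Proof. by move=> ab; rewrite (@cnt_cat B a b) ?cnt1; lia. Qed.

Lemma int_interval_ind (Q : int -> Prop) a :
  Q a -> (forall b, a <= b -> Q b -> Q (b + 1)) -> forall b, a <= b -> Q b.
Proof.
move=> Qa QS b ab; rewrite -(subrK a b) addrC.
have : 0 <= b - a by lia.
case: (b - a) => // m _; elim: m => [|m IHm]; first by rewrite addr0.
by have := QS _ _ IHm; rewrite (_ : a + m%:Z + 1 = a + m.+1%:Z); [apply; lia | lia].
Qed.

Lemma cnt_shift B a b e : cnt (fun z => B (z + e)) a b = cnt B (a + e) (b + e).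
Proof.
rewrite /cnt (_ : absz (b + e - (a + e))%R = absz (b - a)%R); last lia.
by apply: eq_count => i /=; rewrite addrAC.
Qed.

Lemma cnt_opp B a b : a <= b -> cnt (fun z => B (- z)) a b = cnt B (1 - b) (1 - a).
Proof.
move: b; apply: int_interval_ind => [|b ab IHb]; first by rewrite !cnt_id.
rewrite cnt_recr // IHb addnC [RHS]cnt_recl; last lia.
rewrite (_ : 1 - (b + 1) = - b); last lia.
by rewrite (_ : - b + 1 = 1 - b) //; lia.
Qed.

Lemma cnt_le B1 B2 a b : a <= b -> (forall z, a <= z -> z < b -> B1 z -> B2 z) ->
  (cnt B1 a b <= cnt B2 a b)%N.
Proof.
move: b; apply: int_interval_ind => [|b ab IHb] h; first by rewrite !cnt_id.
rewrite !cnt_recr //; apply: leq_add; first by apply: IHb => z az zb; apply: h; lia.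
by case: (B1 b) (h b) => // /(_ ab _ isT) -> //; lia.
Qed.

Lemma eq_cnt B1 B2 a b : a <= b -> (forall z, a <= z -> z < b -> B1 z = B2 z) ->
  cnt B1 a b = cnt B2 a b.
Proof.
by move=> ab h; apply/eqP; rewrite eqn_leq !cnt_le // => z az zb; rewrite h.
Qed.

Lemma cntID C B a b : a <= b ->
  cnt B a b = (cnt (fun z => B z && C z) a b + cnt (fun z => B z && ~~ C z) a b)%N.
Proof.
move: b; apply: int_interval_ind => [|b ab IHb]; first by rewrite !cnt_id.
by rewrite !cnt_recr // IHb; case: (B b) (C b) => [] []; lia.
Qed.

Lemma cnt_gt0 B a b : a <= b -> (0 < cnt B a b)%N -> exists2 z, a <= z < b & B z.
Proof.
move: b; apply: int_interval_ind => [|b ab IHb]; first by rewrite cnt_id.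
rewrite cnt_recr //; case Bb: (B b); first by exists b => //; lia.
by rewrite addn0 => /IHb [z zab Bz]; exists z => //; lia.
Qed.

Lemma cnt_period B n a b : (forall z, B (z + n%:Z) = B z) ->
  cnt B a (a + n%:Z) = cnt B b (b + n%:Z).
Proof.
move=> per; have aux c d : c <= d -> cnt B c (c + n%:Z) = cnt B d (d + n%:Z).
  move: d; apply: int_interval_ind => // d cd ->.
  case: n per => [|m] per; first by rewrite !addr0 !cnt_id.
  rewrite cnt_recl; last lia.
  rewrite (_ : d + 1 + m.+1%:Z = d + m.+1%:Z + 1); last lia.
  by rewrite [RHS]cnt_recr ?per 1?addnC //; lia.
by case: (lerP a b) => [/aux //|/ltW/aux ->].
Qed.

Lemma cnt_max B a b z : a <= z < b -> B z ->
  exists m, [/\ z <= m < b, B m & forall r, m < r -> r < b -> ~~ B r].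
Proof.
move=> /andP[az zb] Bz; have {zb} : z + 1 <= b by lia.
move: b; apply: int_interval_ind => [|b zb [m [zm Bm hm]]].
  by exists z; split=> // [|r]; lia.
case Bb: (B b); first by exists b; split=> // [|r]; lia.
exists m; split=> // [|r mr rb]; first lia.
by have [->|rb'] := eqVneq r b; [rewrite Bb | apply: hm; lia].
Qed.

End Count.

Section Arc.
Variables (G : sgraph) (P : int -> G).
Implicit Types (B : int -> bool) (a b : int).

Definition window B a b : {set G} := [set v |
   has (fun i : nat => (P (a + i%:Z) == v) && B (a + i%:Z)) (iota 0 `|b - a|%N)].

Lemma in_window B a b v : a <= b ->
  reflect (exists z, [/\ a <= z < b, B z & v = P z]) (v \in window B a b).
Proof.
move=> ab; rewrite inE; apply: (iffP hasP) => [[i]|[z [zab Bz ->]]].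
  rewrite mem_iota => ib /andP[/eqP <- Bi]; exists (a + i%:Z); split=> //; lia.
exists `|z - a|%N; first by rewrite mem_iota; lia.
by rewrite (_ : a + _ = z) ?eqxx //; lia.
Qed.

Lemma card_window n B a b : lcycle P n -> a <= b -> b <= a + n%:Z -> #|window B a b| = cnt B a b.
Proof.
move=> lc; move: b; apply: int_interval_ind => [_|b ab IHb bn].
  rewrite cnt_id; apply: eq_card0 => v; apply/negP => /in_window [] // z [zab _ _]; lia.
rewrite cnt_recr // -IHb; last lia.
have windowS : window B a (b + 1) = (if B b then [set P b] else set0) :|: window B a b.
  apply/setP=> v; rewrite !in_setU; apply/in_window/orP; first lia.
    case=> z [zab Bz ->]; have [E|zb] := eqVneq z b; first by left; rewrite -E Bz set11.
    by right; apply/in_window => //; exists z; split=> //; lia.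
  case=> [|/in_window[] // z [zab Bz ->]]; last by exists z; split=> //; lia.
  by case Bb: (B b); rewrite inE // => /eqP ->; exists b; split=> //; lia.
rewrite windowS; case: (B b); last by rewrite set0U addn0.
rewrite cardsU1 addnC; congr addn; apply/eqP; rewrite eqb1; apply/in_window => //.
by case=> z [zab _ /esym E]; have := lcycle_inj lc _ _ E; lia.
Qed.

End Arc.

Lemma independentP (G : sgraph) (S : {set G}) :
  (forall u v, u \in S -> v \in S -> ~~ adj u v) -> independent S.
Proof. by move=> h; apply/forall_inP => u uS; apply/forall_inP => v vS; apply: h. Qed.

(** * Neighbours of the vertex off the cycle *)

Section Neighbours.
Variables (G : sgraph) (n : nat) (x : G) (P : int -> G) (bP : base P n x).
Implicit Types (B : int -> bool) (z w a b f h r q : int) (u v y : G).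
Let lc := base_lcycle bP.
Let per := lcycle_period lc.

Lemma base_onC v : adj x v -> exists z, v = P z.
Proof.
move=> xv; have [|nv] := boolP (v \in seg P 0 n%:Z).
  by move=> /mem_seg[] // z _ ->; exists z.
suff ov z : P z != v by have := base_out bP (base_off bP) ov; rewrite xv.
apply: contraNneq nv => <-; have [w hw E] := lcycle_reprP lc z 0.
by apply/mem_seg; [lia | exists w; [lia | have := E 0; rewrite !addr0]].
Qed.

Lemma cnt_nbr a : cnt (fun z => adj x (P z)) a (a + n%:Z) = deg x.
Proof.
rewrite -(card_window _ lc) //; try lia; apply: eq_card => v.
rewrite inE; apply/in_window/idP; first lia; first by case=> z [_ e ->].
move=> xv; have [z E] := base_onC xv; have [w hw Ew] := lcycle_reprP lc z a.
by exists w; have := Ew 0; rewrite !addr0 E => Ezw; rewrite Ezw -E.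
Qed.

Lemma succ_off_x z : adj x (P (z - 1)) -> ~~ adj x (P z).
Proof. by move=> e; have := nbr_not_consecutive bP e; rewrite subrK. Qed.

Lemma pred_off_x z : adj x (P (z + 1)) -> ~~ adj x (P z).
Proof. by apply: contraL; apply: (nbr_not_consecutive bP). Qed.

Lemma succ_succ z w : adj x (P (z - 1)) -> adj x (P (w - 1)) -> ~~ adj (P z) (P w).
Proof. by move=> ez ew; have := succ_indep bP ez ew; rewrite !subrK. Qed.

Lemma pred_pred z w : adj x (P (z + 1)) -> adj x (P (w + 1)) -> ~~ adj (P z) (P w).
Proof. by move=> ez ew; have := pred_indep bP ez ew; rewrite !addrK. Qed.

(** Both sides count neighbours of [x], in the range moved one step back and one step forward. Apart
    from the positions strictly between [f] and [h], which are common, each range has a single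
    neighbour: [P (f - 1)] or [P (h + 1)]. *)
Lemma cnt_succ_pred f h : f <= h ->
  adj x (P (f - 1)) -> adj x (P (h + 1)) -> ~~ adj x (P f) -> ~~ adj x (P h) ->
  cnt (fun z => adj x (P (z - 1))) f (h + 1) = cnt (fun z => adj x (P (z + 1))) f (h + 1).
Proof.
move=> fh af ah nf nh; rewrite !(cnt_shift (fun w => adj x (P w))).
rewrite cnt_recl ?subrK ?af; last lia.
have [->|fh'] := eqVneq f h; first by rewrite addrK cnt_id cnt1 ah.
rewrite addrK cnt_recl ?(negbTE nf); last lia.
rewrite (@cnt_recr _ (f + 1) (h + 1)) ?ah; last lia.
by rewrite (@cnt_recr _ (f + 1) h) ?(negbTE nh); lia.
Qed.

End Neighbours.

(** * Freeness applied to positions on the cycle *)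

Section Cover.
Variables (G : sgraph) (k n : nat) (x : G).
Hypotheses (fr : induced_free (P2_kP1 k) G) (deg_x : (k <= deg x)%N).
Implicit Types (P : int -> G) (B : int -> bool) (z w a b f h r q : int) (u v y : G).

Lemma cover_window P u v B a b : lcycle P n -> adj u v -> a <= b -> b <= a + n%:Z ->
  (forall z w, a <= z < b -> a <= w < b -> B z -> B w -> ~~ adj (P z) (P w)) ->
  (forall z, a <= z < b -> B z -> ~~ adj u (P z) && ~~ adj v (P z)) ->
  (cnt B a b < k)%N.
Proof.
move=> lc e ab bn ind nB; rewrite -(card_window _ lc) //; apply: (edge_cover fr e).
  apply: independentP => _ _ /in_window[] // z [zab Bz ->] /in_window[] // w [wab Bw ->].
  exact: ind.
by move=> _ /in_window[] // z [zab Bz ->]; apply: nB.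
Qed.

(** The vertex [x] itself is one more common non-neighbour, which gains one over [cover_window]. *)
Lemma cover_window_x P u v B a b : base P n x -> adj u v -> a <= b -> b <= a + n%:Z ->
  (forall z w, a <= z < b -> a <= w < b -> B z -> B w -> ~~ adj (P z) (P w)) ->
  (forall z, a <= z < b -> B z -> [&& ~~ adj u (P z), ~~ adj v (P z) & ~~ adj x (P z)]) ->
  ~~ adj x u -> ~~ adj x v ->
  (cnt B a b + 1 < k)%N.
Proof.
move=> bP e ab bn ind nB xu xv; rewrite -(card_window _ (base_lcycle bP)) //.
have xB : x \notin window P B a b.
  by apply/in_window => // -[z [_ _ /eqP]]; rewrite eq_sym; apply/negP/(base_off bP).
rewrite addnC -[1%N]/(true : nat) -xB -cardsU1; apply: (edge_cover fr e).
  apply: independentP => u' v'; rewrite !in_setU1.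
  case/orP=> [/eqP->|/in_window[] // z [zab Bz ->]]; case/orP=> [/eqP->|/in_window[] // w [wab Bw ->]].
  - by rewrite adj_irrefl.
  - by have /and3P[] := nB _ wab Bw.
  - by have /and3P[_ _] := nB _ zab Bz; rewrite adj_sym.
  - exact: ind.
move=> v'; rewrite in_setU1 => /orP[/eqP->|/in_window[] // z [zab Bz ->]].
  by rewrite ![adj _ x]adj_sym xu.
by have /and3P[-> ->] := nB _ zab Bz.
Qed.

(** By [two_succ_out], [y] would see no second successor, so its edge to [P z] would miss the other
    [deg x - 1] successors and [x]: at least [k] independent vertices. *)
Lemma succ_out P y z : base P n x -> (forall z, P z != y) -> adj x (P (z - 1)) -> ~~ adj y (P z).
Proof.
move=> bP oy az; apply/negP => e; have lc := base_lcycle bP.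
have yx : y != x by apply: contraTneq e => ->; apply: (succ_off_x bP).
suff : (cnt (fun w => adj x (P (w - 1)%R)) (z + 1) (z + n%:Z) + 1 < k)%N.
  have := cnt_nbr bP (z - 1); rewrite (cnt_shift (fun w => adj x (P w))) addrK cnt_recl;
    last by have := lcycle_gt2 lc; lia.
  rewrite subrK az (_ : z + n%:Z - 1 = z - 1 + n%:Z); lia.
have off_adj : ~~ adj x y by apply: (base_out bP) => //; apply: (base_off bP).
apply: (cover_window_x bP e) => //; try by have := lcycle_gt2 lc; lia.
- by move=> w w' _ _; apply: (succ_succ bP).
- move=> w hw aw; rewrite (succ_succ bP) // (succ_off_x bP) // !andbT.
  apply/negP => e'; apply: (@two_succ_out _ _ _ _ bP y (z - 1) (w - 1)) => //; try lia.
    by rewrite subrK.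
  by rewrite subrK.
- exact: (succ_off_x bP).
Qed.

End Cover.

(** * Edges between successors and predecessors *)

Section Stars.
Variables (G : sgraph) (n : nat) (x : G).
Implicit Types (P : int -> G) (B : int -> bool) (z w a b f h r q : int) (u v y : G).

Definition sees_succ P v := has (fun i : nat => adj x (P (i%:Z - 1)) && adj v (P i%:Z)) (iota 0 n).
Definition sees_pred P v := has (fun i : nat => adj x (P (i%:Z + 1)) && adj v (P i%:Z)) (iota 0 n).
(** Stars are the ends of edges between successors and predecessors; dropping the stars of one kind
    makes a mixed set independent. *)
Definition star_succ P z := adj x (P (z - 1)) && sees_pred P (P z).
Definition star_pred P z := adj x (P (z + 1)) && sees_succ P (P z).

Lemma sees_succP P v : lcycle P n ->
  reflect (exists2 z, adj x (P (z - 1)) & adj v (P z)) (sees_succ P v).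
Proof.
move=> lc; apply: (iffP hasP) => [[i _ /andP[? ?]]|[z az ev]]; first by exists i%:Z.
have [w hw E] := lcycle_reprP lc z 0; exists `|w|%N; first by rewrite mem_iota; lia.
rewrite (_ : `|w|%N%:Z = w); last lia.
by have := E 0; rewrite !addr0 => ->; rewrite E az.
Qed.

Lemma sees_predP P v : lcycle P n ->
  reflect (exists2 z, adj x (P (z + 1)) & adj v (P z)) (sees_pred P v).
Proof.
move=> lc; apply: (iffP hasP) => [[i _ /andP[? ?]]|[z az ev]]; first by exists i%:Z.
have [w hw E] := lcycle_reprP lc z 0; exists `|w|%N; first by rewrite mem_iota; lia.
rewrite (_ : `|w|%N%:Z = w); last lia.
by have := E 0; rewrite !addr0 => ->; rewrite E az.
Qed.

Lemma sees_succ_opp P v : lcycle P n -> sees_succ (fun z => P (- z)) v = sees_pred P v.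
Proof.
move=> lc; apply/(sees_succP _ (lcycle_opp lc))/(sees_predP _ lc) => -[z az ez].
  by exists (- z) => //; rewrite -[1]opprK -opprD.
by exists (- z); rewrite ?opprD !opprK.
Qed.

Lemma sees_pred_opp P v : lcycle P n -> sees_pred (fun z => P (- z)) v = sees_succ P v.
Proof.
move=> lc; apply/(sees_predP _ (lcycle_opp lc))/(sees_succP _ lc) => -[z az ez].
  by exists (- z) => //; rewrite -opprD.
by exists (- z); rewrite ?opprD !opprK.
Qed.

Lemma star_succ_opp P z : lcycle P n -> star_succ (fun z => P (- z)) z = star_pred P (- z).
Proof. by move=> lc; rewrite /star_succ sees_pred_opp // /star_pred opprD opprK. Qed.

Lemma star_pred_opp P z : lcycle P n -> star_pred (fun z => P (- z)) z = star_succ P (- z).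
Proof. by move=> lc; rewrite /star_pred sees_succ_opp // /star_succ opprD. Qed.

Lemma star_succ_period P z : lcycle P n -> star_succ P (z + n%:Z) = star_succ P z.
Proof. by move=> lc; rewrite /star_succ addrAC !(lcycle_period lc). Qed.

Lemma star_pred_period P z : lcycle P n -> star_pred P (z + n%:Z) = star_pred P z.
Proof. by move=> lc; rewrite /star_pred addrAC !(lcycle_period lc). Qed.

Variable k : nat.
Hypothesis fr : induced_free (P2_kP1 k) G.

(** The edge from [P f] to [P (f + 1)] misses the later successors up to [h] and the predecessors
    after [h], by the choice of [h] and two reroutings. With few stars, too many of these would form
    an independent set. *)
Lemma count_star_last P f h : base P n x -> f < h < f + n%:Z ->
  adj x (P (f - 1)) -> adj x (P (h + 1)) -> adj (P f) (P h) ->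
  (forall r, h < r < f + n%:Z -> adj x (P (r + 1)) -> ~~ adj (P f) (P r)) ->
  (deg x + 2 <= k + cnt (star_succ P) f (h + 1))%N /\
  (deg x + 1 <= k + cnt (star_pred P) (h + 1) (f + n%:Z))%N.
Proof.
move=> bP fh af ah e hmax; have lc := base_lcycle bP; have n3 := lcycle_gt2 lc.
have ef : adj (P f) (P (f + 1)) by apply: (lcycle_adj lc).
have nf1 : ~~ adj x (P (f + 1)).
  by apply: contraL e => af1; apply: (pred_pred bP).
have nf : ~~ adj x (P f) by apply: (succ_off_x bP).
have nh : ~~ adj x (P h) by apply: (pred_off_x bP).
have sp_x z : adj x (P (z + 1)) -> ~~ adj x (P z) by apply: (pred_off_x bP).
have ss_x z : adj x (P (z - 1)) -> ~~ adj x (P z) by apply: (succ_off_x bP).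
have missT z : h < z < f + n%:Z -> adj x (P (z + 1)) ->
    ~~ adj (P f) (P z) && ~~ adj (P (f + 1)) (P z).
  move=> hz az; rewrite hmax //=; apply/negP => e'.
  by apply: (crossing_pred_pred bP _ _ _ az ah e e'); lia.
have missS z : f < z <= h -> adj x (P (z - 1)) ->
    ~~ adj (P f) (P z) && ~~ adj (P (f + 1)) (P z).
  move=> hz az; rewrite (succ_succ bP) //=; apply/negP => e'.
  have zf : z != f + 1 by apply: contraNneq nf => zf; rewrite zf addrK in az.
  by apply: (crossing_pred_succ bP _ _ _ az ah e e'); lia.
have sf : star_succ P f.
  by rewrite /star_succ af; apply/(sees_predP _ lc); exists h.
have f1h1 : f + 1 <= h + 1 by lia.
have fh1 : f <= h + 1 by lia.
(* Starred successors are dropped here. As [f] is itself a star, starting the range at [f + 1] loses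
   nothing. *)
pose B1 z := if z <= h then adj x (P (z - 1)) && ~~ sees_pred P (P z) else adj x (P (z + 1)).
have c1 : (cnt B1 (f + 1) (f + n%:Z) + 1 < k)%N.
  apply: (cover_window_x fr bP ef _ _ _ _ nf nf1); [lia | lia | |].
  - move=> z w _ _; rewrite /B1; case: ifP => _; case: ifP => _.
    + by move=> /andP[az _] /andP[aw _]; apply: (succ_succ bP).
    + move=> /andP[_ /(sees_predP _ lc) st] aw; apply/negP => e'.
      by apply: st; exists w.
    + move=> az /andP[_ /(sees_predP _ lc) st]; rewrite adj_sym; apply/negP => e'.
      by apply: st; exists z.
    + by apply: (pred_pred bP).
  - move=> z hz; rewrite /B1; case: ifP => zh.
      by move=> /andP[az _]; rewrite andbA (missS _ _ az) ?(ss_x _ az) //; lia.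
    by move=> az; rewrite andbA (missT _ _ az) ?(sp_x _ az) //; lia.
(* Starred predecessors are dropped instead. Now the omission of [f] costs one, so the second bound
   is weaker by one. *)
pose B2 z := if z <= h then adj x (P (z - 1)) else adj x (P (z + 1)) && ~~ sees_succ P (P z).
have c2 : (cnt B2 (f + 1) (f + n%:Z) + 1 < k)%N.
  apply: (cover_window_x fr bP ef _ _ _ _ nf nf1); [lia | lia | |].
  - move=> z w _ _; rewrite /B2; case: ifP => _; case: ifP => _.
    + by apply: (succ_succ bP).
    + move=> az /andP[_ /(sees_succP _ lc) st]; rewrite adj_sym; apply/negP => e'.
      by apply: st; exists z.
    + move=> /andP[_ /(sees_succP _ lc) st] aw; apply/negP => e'.
      by apply: st; exists w.
    + by move=> /andP[az _] /andP[aw _]; apply: (pred_pred bP).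
  - move=> z hz; rewrite /B2; case: ifP => zh.
      by move=> az; rewrite andbA (missS _ _ az) ?(ss_x _ az) //; lia.
    by move=> /andP[az _]; rewrite andbA (missT _ _ az) ?(sp_x _ az) //; lia.
clear missS missT hmax; have h1n : h + 1 <= f + n%:Z by lia.
have eqB1 : cnt B1 (f + 1) (f + n%:Z) =
    (cnt (fun z => adj x (P (z - 1)%R) && ~~ sees_pred P (P z)) (f + 1)%R (h + 1)%R +
     cnt (fun z => adj x (P (z + 1)%R)) (h + 1)%R (f + n%:Z)%R)%N.
  rewrite (cnt_cat _ f1h1 h1n); congr addn; apply: eq_cnt => // z hz zf; rewrite /B1.
    by rewrite ifT //; lia.
  by rewrite ifF //; lia.
have eqB2 : cnt B2 (f + 1) (f + n%:Z) =
    (cnt (fun z => adj x (P (z - 1)%R)) (f + 1)%R (h + 1)%R +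
     cnt (fun z => adj x (P (z + 1)%R) && ~~ sees_succ P (P z)) (h + 1)%R (f + n%:Z)%R)%N.
  rewrite (cnt_cat _ f1h1 h1n); congr addn; apply: eq_cnt => // z hz zf; rewrite /B2.
    by rewrite ifT //; lia.
  by rewrite ifF //; lia.
have cS := cnt_nbr bP (f - 1); have cT := cnt_nbr bP (f + 1).
(* By this equality the successors from [f] to [h] and the predecessors after [h] number exactly
   [deg x]. *)
have E := cnt_succ_pred (f := f) (h := h) _ af ah nf nh.
have {}E : cnt (fun z => adj x (P (z - 1))) f (h + 1) =
  cnt (fun z => adj x (P (z + 1))) f (h + 1) by apply: E; lia.
rewrite (_ : f + 1 + n%:Z = f + n%:Z + 1) in cT; last lia.
rewrite -(cnt_shift (fun w => adj x (P w))) (@cnt_cat _ f (h + 1)) in cT; try lia.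
have := cntID (fun z => sees_pred P (P z)) (fun z => adj x (P (z - 1))) fh1.
rewrite [X in _ = (_ + X)%N]cnt_recl /=; last lia.
move: (sf); rewrite /star_succ => /andP[_ ->]; rewrite andbF => i1.
have := cntID (fun z => sees_succ P (P z)) (fun z => adj x (P (z + 1))) h1n => i2.
have E' := E; rewrite [X in X = _]cnt_recl ?af in E'; last lia.
by rewrite /star_pred; lia.
Qed.

Lemma count_star_first P f h : base P n x -> f < h < f + n%:Z ->
  adj x (P (f - 1)) -> adj x (P (h + 1)) -> adj (P f) (P h) ->
  (forall r, h - n%:Z < r < f -> adj x (P (r - 1)) -> ~~ adj (P h) (P r)) ->
  (deg x + 2 <= k + cnt (star_pred P) f (h + 1))%N /\
  (deg x + 1 <= k + cnt (star_succ P) (h + 1) (f + n%:Z))%N.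
Proof.
move=> bP fh af ah e fmin; have lc := base_lcycle bP; have n3 := lcycle_gt2 lc.
have H0 : - h < - f < - h + n%:Z by lia.
have H1 : adj x (P (- (- h - 1))) by rewrite (_ : - (- h - 1) = h + 1) //; lia.
have H2 : adj x (P (- (- f + 1))) by rewrite (_ : - (- f + 1) = f - 1) //; lia.
have H3 : adj (P (- - h)) (P (- - f)) by rewrite !opprK adj_sym.
have H4 r : - f < r < - h + n%:Z -> adj x (P (- (r + 1))) -> ~~ adj (P (- - h)) (P (- r)).
  move=> hr ar; rewrite opprK; apply: fmin; first lia.
  by rewrite (_ : - r - 1 = - (r + 1)) //; lia.
have [] := count_star_last (base_opp bP) H0 H1 H2 H3 H4.
have E1 : cnt (star_succ (fun z => P (- z))) (- h) (- f + 1) = cnt (star_pred P) f (h + 1).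
  transitivity (cnt (fun z => star_pred P (- z)) (- h) (- f + 1)).
    by apply: eq_cnt => [|z _ _]; [lia | rewrite star_succ_opp].
  by rewrite cnt_opp; [congr cnt; lia | lia].
have E2 : cnt (star_pred (fun z => P (- z))) (- f + 1) (- h + n%:Z) =
    cnt (star_succ P) (h + 1) (f + n%:Z).
  transitivity (cnt (fun z => star_succ P (- z)) (- f + 1) (- h + n%:Z)).
    by apply: eq_cnt => [|z _ _]; [lia | rewrite star_pred_opp].
  rewrite cnt_opp; last lia.
  transitivity (cnt (fun z => star_succ P (z + n%:Z)) (1 - (- h + n%:Z)) (1 - (- f + 1))).
    by apply: eq_cnt => [|z _ _]; [lia | rewrite star_succ_period].
  by rewrite cnt_shift; congr cnt; lia.
by rewrite E1 E2.
Qed.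

End Stars.

(** * Vertices missed by longest cycles *)

Definition missed (G : sgraph) n (v : G) :=
  exists c : seq G, [/\ ucycle adj c, size c = n & v \notin c].

Section Missed.
Variables (G : sgraph) (k n : nat) (x : G).
Hypotheses (fr : induced_free (P2_kP1 k) G).
Implicit Types (P : int -> G) (B : int -> bool) (z w a b f h r q : int) (u v y : G).

Definition succ_nbr P v w := adj x (P (w - 1)) && adj v (P w).
Definition pred_nbr P v w := adj x (P (w + 1)) && adj v (P w).

(** The edge from [P z] to [v] misses every other successor not adjacent to [v], and also [x] if [v]
    is not adjacent to [x]. Since fewer than [k] vertices can be missed, [v] sees the remaining
    ones. *)
Lemma count_succ P z v : base P n x -> adj x (P (z - 1)) -> adj (P z) v ->
  (deg x + ~~ adj x v <= k + cnt (succ_nbr P v) (z + 1)%R (z + n%:Z)%R)%N.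
Proof.
move=> bP az e; have lc := base_lcycle bP; have n3 := lcycle_gt2 lc.
have zn : z + 1 <= z + n%:Z by lia.
have zn' : z + n%:Z <= z + 1 + n%:Z by lia.
pose B w := adj x (P (w - 1)) && ~~ adj v (P w).
have indB w w' : z + 1 <= w < z + n%:Z -> z + 1 <= w' < z + n%:Z -> B w -> B w' ->
    ~~ adj (P w) (P w').
  by move=> _ _ /andP[aw _] /andP[aw' _]; apply: (succ_succ bP).
have nB w : z + 1 <= w < z + n%:Z -> B w -> ~~ adj (P z) (P w) && ~~ adj v (P w).
  by move=> _ /andP[aw ->]; rewrite (succ_succ bP).
have cB : (cnt B (z + 1) (z + n%:Z) + ~~ adj x v < k)%N.
  case xv: (adj x v); first by rewrite addn0; apply: (cover_window fr lc e zn zn' indB nB).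
  apply: (cover_window_x fr bP e zn zn' indB); last by rewrite xv.
    by move=> w hw Bw; rewrite andbA nB //=; case/andP: Bw => aw _; apply: (succ_off_x bP).
  exact: (succ_off_x bP).
have := cntID (fun w => adj v (P w)) (fun w => adj x (P (w - 1))) zn.
have cD : (deg x = 1 + cnt (fun w => adj x (P (w - 1)%R)) (z + 1)%R (z + n%:Z)%R)%N.
  rewrite -(cnt_nbr bP (z - 1)) (_ : z - 1 + n%:Z = z + n%:Z - 1); last lia.
  by rewrite -(cnt_shift (fun w => adj x (P w))) cnt_recl ?az //; lia.
rewrite -/B -/(succ_nbr P v); lia.
Qed.

Lemma count_pred P z v : base P n x -> adj x (P (z + 1)) -> adj (P z) v ->
  (deg x + ~~ adj x v <= k + cnt (pred_nbr P v) (z + 1)%R (z + n%:Z)%R)%N.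
Proof.
move=> bP az e; have lc := base_lcycle bP; have n3 := lcycle_gt2 lc.
have H0 : adj x (P (- (- z - 1))) by rewrite (_ : - (- z - 1) = z + 1) //; lia.
have H1 : adj (P (- - z)) v by rewrite opprK.
have := count_succ (base_opp bP) H0 H1.
set c1 := cnt _ _ _; set c2 := cnt _ _ _; suff -> : c1 = c2 by [].
rewrite {}/c1 {}/c2.
transitivity (cnt (fun w => pred_nbr P v (- w)) (- z + 1) (- z + n%:Z)).
  by apply: eq_cnt => [|w _ _] /=; [lia | rewrite /pred_nbr (_ : - w + 1 = - (w - 1)) //; lia].
rewrite cnt_opp; last lia.
transitivity (cnt (fun w => pred_nbr P v (w + n%:Z))
   (1 - (- z + n%:Z)) (1 - (- z + 1))).
  by apply: eq_cnt => [|w _ _] /=; [lia | rewrite /pred_nbr addrAC !(lcycle_period lc)].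
by rewrite cnt_shift; congr cnt; lia.
Qed.

Hypothesis deg_x : (k <= deg x)%N.

(** The vertex [x] replaces [P z], directly if it is adjacent to [P (z + 1)]. Otherwise [count_succ]
    gives another successor [P w] adjacent to [P (z + 1)], and the cycle becomes [x], [P (w - 1)]
    down to [P (z + 1)], [P w] up to [P (z - 1)]. *)
Lemma succ_missed P z : base P n x -> adj x (P (z - 1)) -> missed n (P z).
Proof.
move=> bP az; have lc := base_lcycle bP; have n3 := lcycle_gt2 lc.
have az' : adj x (P (z + n%:Z - 1)).
  by rewrite -(lcycle_period lc) in az; rewrite (_ : z + _ - 1 = z - 1 + n%:Z) //; lia.
have build p v : walk x v p -> adj v x -> perm_eq (P z :: p) (x :: seg P z (z + n%:Z)) ->
    missed n (P z).
  move=> wp e pp.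
  have u : uniq (P z :: p).
    by rewrite (perm_uniq pp) -[x :: _]/([:: x] ++ _) (uniq_off lc) //; apply: (off_x bP).
  exists p; split; last by case/andP: u.
    by rewrite /ucycle (walk_cycle wp e); case/andP: u.
  by have := perm_size pp; rewrite /= size_seg; lia.
have sz : seg P z (z + n%:Z) = P z :: seg P (z + 1) (z + n%:Z).
  by rewrite (@seg_cat _ _ z (z + 1)) ?seg1 //; lia.
case az1: (adj x (P (z + 1))).
  have w1 : walk (P (z + 1)) (P (z + n%:Z - 1)) (seg P (z + 1) (z + n%:Z)).
    by apply: walk_segE; [exact: (lcycle_adj lc) | lia | lia].
  apply: (build (x :: seg P (z + 1) (z + n%:Z)) (P (z + n%:Z - 1))).
  - exact: (walk_cons w1 az1).
  - by rewrite adj_sym.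
  - by rewrite sz (perm_catCA [:: P z] [:: x]).
have := count_succ bP az (lcycle_adj lc z); rewrite az1.
set c := cnt _ _ _ => hc; have c0 : (0 < c)%N by lia.
have [|w hw /andP[aw ew]] := cnt_gt0 _ c0; first lia.
have zw : w != z + 1 by apply: contraTneq ew => ->; rewrite adj_irrefl.
have w1 : walk (P (w - 1)) (P (z + 1)) (rev (seg P (z + 1) w)).
  by apply: walk_rev; apply: walk_segE; [exact: (lcycle_adj lc) | lia | lia].
have w2 : walk (P w) (P (z + n%:Z - 1)) (seg P w (z + n%:Z)).
  by apply: walk_segE; [exact: (lcycle_adj lc) | lia | lia].
apply: (build _ _ (walk_cons (walk_cat w1 w2 ew) aw)); first by rewrite adj_sym.
rewrite sz (@seg_cat _ _ (z + 1) w (z + n%:Z)); try lia.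
permute_segments.
Qed.

Lemma pred_missed P z : base P n x -> adj x (P (z + 1)) -> missed n (P z).
Proof.
move=> bP az; have := succ_missed (base_opp bP) (z := - z).
by rewrite opprK (_ : - (- z - 1) = z + 1); [apply | lia].
Qed.

End Missed.

(** * Degree bounds from extremal chords *)

Section Bounds.
Variables (G : sgraph) (k n : nat) (x : G).
Hypotheses (fr : induced_free (P2_kP1 k) G).
Implicit Types (P : int -> G) (B : int -> bool) (z w a b f h r q : int) (u v y : G).

Lemma star_succ_last P f : lcycle P n -> star_succ n x P f ->
  exists h, [/\ f < h < f + n%:Z, adj x (P (h + 1)), adj (P f) (P h) &
    forall r, h < r < f + n%:Z -> adj x (P (r + 1)) -> ~~ adj (P f) (P r)].
Proof.
move=> lc /andP[af /(sees_predP x (P f) lc) [r0 ar0 e0]].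
have [r hr E] := lcycle_reprP lc r0 f.
have ar : adj x (P (r + 1)) by rewrite E.
have er : adj (P f) (P r) by have := E 0; rewrite !addr0 => ->.
have rf : r != f by apply: contraTneq er => ->; rewrite adj_irrefl.
have [|m [hm /andP[am em] mmax]] := @cnt_max (pred_nbr x P (P f)) f (f + n%:Z) r hr.
  by apply/andP.
exists m; split=> //; first lia.
by move=> s /andP[ms sf] as_; apply: contra (mmax s ms sf) => es; apply/andP.
Qed.

Lemma star_pred_first P h : lcycle P n -> star_pred n x P h ->
  exists f, [/\ f < h < f + n%:Z, adj x (P (f - 1)), adj (P f) (P h) &
    forall r, h - n%:Z < r < f -> adj x (P (r - 1)) -> ~~ adj (P h) (P r)].
Proof.
move=> lc st; have lc' := lcycle_opp lc.
have [|m [hm am em mmax]] := star_succ_last (f := - h) lc'.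
  by rewrite star_succ_opp // opprK.
rewrite opprK in em; exists (- m); split; first lia.
- by rewrite -opprD.
- by rewrite adj_sym.
- move=> r hr ar; have := mmax (- r); rewrite !opprK; apply; first lia.
  by rewrite (_ : - (- r + 1) = r - 1) //; lia.
Qed.

Lemma star_lower_bounds P z : base P n x -> star_succ n x P z ->
  (2 * deg x + 3 <= 2 * k + cnt (star_succ n x P) 0 n%:Z)%N /\
  (2 * deg x + 3 <= 2 * k + cnt (star_pred n x P) 0 n%:Z)%N.
Proof.
move=> bP st; have lc := base_lcycle bP; have n3 := lcycle_gt2 lc.
(* A chord from a successor f to a predecessor h with h - f maximal is extremal at both ends. *)
pose Q (m : nat) := [exists i : 'I_n, [&& (m < n)%N, adj x (P (i%:Z - 1)),
  adj x (P (i%:Z + m%:Z + 1)) & adj (P i%:Z) (P (i%:Z + m%:Z))]].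
have QI f h : f < h < f + n%:Z -> adj x (P (f - 1)) -> adj x (P (h + 1)) ->
    adj (P f) (P h) -> Q `|h - f|%N.
  move=> fh af ah e; have [f' hf' E] := lcycle_reprP lc f 0.
  have f'n : (`|f'| < n)%N by lia.
  have E1 : adj x (P (f' - 1)) by rewrite E.
  have E2 : adj x (P (f' + `|h - f|%N%:Z + 1)).
    by rewrite -addrA E (_ : f + (_ + 1) = h + 1) //; lia.
  have E3 : adj (P f') (P (f' + `|h - f|%N%:Z)).
    have := E 0; rewrite !addr0 => ->; rewrite E (_ : f + _ = h) //; lia.
  apply/existsP; exists (Ordinal f'n); rewrite /= (_ : `|f'|%N%:Z = f'); last lia.
  by rewrite E1 E2 E3; lia.
have exQ : exists m, Q m.
  have [h [fh ah e _]] := star_succ_last lc st; have /andP[az _] := st.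
  by exists `|h - z|%N; apply: QI.
have ubQ m : Q m -> (m <= n)%N by move=> /existsP[i /and4P[]]; lia.
have [m /existsP[i /and4P[mn af ah e]] mmax] := ex_maxnP exQ ubQ.
have m0 : m != 0%N by apply: contraTneq e => ->; rewrite addr0 adj_irrefl.
set f := i%:Z in af ah e; set h := f + m%:Z in ah e.
have fh : f < h < f + n%:Z by lia.
have [|c1 c2] := count_star_last fr bP fh af ah e.
  move=> r hr ar; apply/negP => er.
  by have := mmax _ (QI _ _ (_ : f < r < f + n%:Z) af ar er); lia.
have [|c3 c4] := count_star_first fr bP fh af ah e.
  move=> r hr ar; apply/negP => er; rewrite adj_sym in er.
  by have := mmax _ (QI _ _ (_ : r < h < r + n%:Z) ar ah er); lia.
have eS : cnt (star_succ n x P) 0 n%:Z = cnt (star_succ n x P) f (f + n%:Z).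
  by rewrite -[n%:Z in LHS]add0r; apply: cnt_period => w; apply: star_succ_period.
have eT : cnt (star_pred n x P) 0 n%:Z = cnt (star_pred n x P) f (f + n%:Z).
  by rewrite -[n%:Z in LHS]add0r; apply: cnt_period => w; apply: star_pred_period.
(* For either kind of star, the arc from [f] to [h] holds at least [deg x + 2 - k] and the rest at
   least [deg x + 1 - k]. *)
rewrite eS eT !(@cnt_cat _ f (h + 1) (f + n%:Z)); lia.
Qed.

(** A starred predecessor comes just before a neighbour of [x] and a starred successor just after
    one. No neighbour serves both, so the two counts, each at least [2 * deg x + 3 - 2 * k], sum to
    at most [deg x]. *)
Lemma deg_no_alternation P z0 : base P n x -> star_succ n x P z0 ->
  (forall z, adj x (P z) -> star_pred n x P (z - 1) -> ~~ star_succ n x P (z + 1)) ->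
  (4 * deg x + 6 <= 4 * k + deg x)%N.
Proof.
move=> bP st noalt; have [c1 c2] := star_lower_bounds bP st.
have lc := base_lcycle bP; have n0 : 0 <= n%:Z by lia.
have := cntID (fun z => star_pred n x P (z - 1)) (fun z => adj x (P z)) n0.
rewrite -[n%:Z]add0r (cnt_nbr bP) /=.
have le1 : (cnt (fun z => star_pred n x P (z - 1)) 0 (0 + n%:Z)%R <=
    cnt (fun z => adj x (P z) && star_pred n x P (z - 1)%R) 0 (0 + n%:Z)%R)%N.
  apply: cnt_le => [|z _ _]; first lia.
  by move=> sz; rewrite sz andbT; case/andP: sz; rewrite subrK.
have le2 : (cnt (fun z => star_succ n x P (z + 1)%R) 0 (0 + n%:Z)%R <=
    cnt (fun z => adj x (P z) && ~~ star_pred n x P (z - 1)%R) 0 (0 + n%:Z)%R)%N.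
  apply: cnt_le => [|z _ _]; first lia.
  move=> sz; have az : adj x (P z) by case/andP: sz; rewrite addrK.
  by rewrite az /=; apply: contraL sz => /(noalt _ az).
have e1 : cnt (fun z => star_pred n x P (z - 1)) 0 (0 + n%:Z) = cnt (star_pred n x P) 0 n%:Z.
  rewrite cnt_shift (_ : 0 + n%:Z + -1 = 0 - 1 + n%:Z); last lia.
  by rewrite (cnt_period _ 0) ?add0r // => w; apply: star_pred_period.
have e2 : cnt (fun z => star_succ n x P (z + 1)) 0 (0 + n%:Z) = cnt (star_succ n x P) 0 n%:Z.
  rewrite cnt_shift (_ : 0 + n%:Z + 1 = 0 + 1 + n%:Z); last lia.
  by rewrite (cnt_period _ 0) ?add0r // => w; apply: star_succ_period.
move: c1 c2; rewrite -e1 -e2 => c1 c2 E.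
have := leq_add le1 le2; rewrite -E; lia.
Qed.

End Bounds.

(* [lia] case-splits on every boolean hypothesis, so forget the adjacencies first. *)
Ltac position_lia := repeat match goal with
  | H : ?T |- _ => match T with context [@adj] => clear H end end; lia.

Section Alternation.
Variables (G : sgraph) (k n : nat) (x : G).
Hypotheses (fr : induced_free (P2_kP1 k) G).
Implicit Types (P : int -> G) (B : int -> bool) (z w a b f h r q : int) (u v y : G).

(* The predecessors adjacent to P (h - 1) end at some m, and the successors adjacent to
   P (f - 1) = P z lie between m and l, so the four counts concern consecutive arcs of the cycle. *)
Lemma deg_alternation P z : base P n x -> (k < deg x)%N ->
  adj x (P z) -> star_pred n x P (z - 1) -> star_succ n x P (z + 1) ->
  (4 * deg x + 4 <= 4 * k + deg x)%N.
Proof.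
move=> bP kD az st ss; have lc := base_lcycle bP; have n3 := lcycle_gt2 lc.
have [f zf] : exists f, z = f - 1 by exists (z + 1); rewrite addrK.
rewrite zf subrK in ss.
have [h [fh ah e hmax]] := star_succ_last lc ss.
have af : adj x (P (f - 1)) by rewrite -zf.
have [c1 _] := count_star_last fr bP fh af ah e hmax.
have st' : star_pred n x P (z - 1 + n%:Z) by rewrite star_pred_period.
have [l [hl al el lmin]] := star_pred_first lc st'.
have at' : adj x (P (z - 1 + n%:Z + 1)) by case/andP: st'.
have [c2 _] := count_star_first fr bP hl al at' el lmin.
have nf : ~~ adj x (P f) by apply: (succ_off_x bP).
have nz : ~~ adj x (P (z - 1)).
  by apply: (pred_off_x bP); rewrite subrK.
have nh : ~~ adj x (P h) by apply: (pred_off_x bP).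
have nh1 : ~~ adj x (P (h - 1)).
  by apply: contraL e => ah1; apply: (succ_succ bP).
have eh : adj (P h) (P (h - 1)).
  by rewrite adj_sym; have := lcycle_adj lc (h - 1); rewrite subrK.
have := count_pred fr bP ah eh; rewrite nh1 => c3.
(* Beyond this point the chord would combine with the one between [P f] and [P h] into
   [crossing_pred_succ] on the edge from [h - 1] to [h]. *)
have Qlt w : h + 1 <= w < h + n%:Z -> pred_nbr x P (P (h - 1)) w -> w < f + n%:Z - 1.
  move=> hw /andP[aw ew].
  have wf1 : w != f + n%:Z - 1.
    apply: contraTneq aw => ->; rewrite subrK (lcycle_period lc); exact: nf.
  have wh : w != h + n%:Z - 1.
    by apply: contraTneq ew => ->; rewrite addrAC (lcycle_period lc) adj_irrefl.
  have [//|ge] := ltrP w (f + n%:Z - 1); exfalso.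
  have afn : adj x (P (f + n%:Z - 1)) by rewrite addrAC (lcycle_period lc).
  have efn : adj (P (h - 1 + 1)) (P (f + n%:Z)) by rewrite subrK (lcycle_period lc) adj_sym.
  have [i1 i2 i3] : [/\ h - 1 + 2 <= f + n%:Z, f + n%:Z <= w & w <= h - 1 + n%:Z - 1].
    by clear -fh n3 hw ge wf1 wh; split; position_lia.
  exact: (crossing_pred_succ bP i1 i2 i3 afn aw ew efn).
have c30 : (0 < cnt (pred_nbr x P (P (h - 1)%R)) (h + 1)%R (h + n%:Z)%R)%N.
  by clear -c3 kD; position_lia.
have [|w0 hw0 Qw0] := cnt_gt0 _ c30; first by clear -fh n3; position_lia.
have [m [hm /andP[am em] mmax]] := cnt_max hw0 Qw0.
have mf : m < f + n%:Z - 1 by apply: Qlt; [position_lia | apply/andP].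
have nm : ~~ adj x (P m) by apply: (pred_off_x bP).
have c3' : (cnt (pred_nbr x P (P (h - 1)%R)) (h + 1) (h + n%:Z) <=
    cnt (fun z => adj x (P (z + 1)%R)) (h + 1)%R (m + 1)%R)%N.
  rewrite (@cnt_cat _ (h + 1) (m + 1)); try position_lia.
  rewrite [X in (_ + X)%N](_ : _ = 0%N); last first.
    apply/eqP; rewrite -leqn0 leqNgt; apply/negP => /cnt_gt0 [|r hr Qr]; first position_lia.
    by have := mmax r; rewrite Qr => h0; have := h0 _ _; position_lia.
  by rewrite addn0; apply: cnt_le => [|r _ _ /andP[]]; first position_lia.
have ef : adj (P f) (P (f - 1)).
  by rewrite adj_sym; have := lcycle_adj lc (f - 1); rewrite subrK.
have := count_succ fr bP af ef; rewrite af addn0 => c4.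
(* Up to [m] the chord to [v] would complete [crossing_three_chords]; after [l],
   [crossing_succ_succ] on the edge from [z - 1] to [z]. *)
have Vin (v : int) : f + 1 <= v < f + n%:Z -> succ_nbr x P (P (f - 1)) v -> m + 1 <= v < l + 1.
  move=> hv /andP[av ev]; apply/andP; split.
    have [mv|vm] := ltrP m v; first position_lia.
    exfalso; have vh : v != h by apply: contraNneq nh1 => <-.
    have [i1 i2 i3] : [/\ f < h, h < m & f < v] by clear -fh hm hw0 hv; split; position_lia.
    rewrite adj_sym in e; exact: (crossing_three_chords bP i1 i2 mf i3 vm vh am av e em ev).
  have [lv|vl] := ltrP l v; last position_lia.
  exfalso; have vfn : v != f - 1 + n%:Z.
    by apply: contraTneq ev => ->; rewrite (lcycle_period lc) adj_irrefl.
  have lz : l != z by apply: contraNneq nz => <-.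
  have el' : adj (P (z - 1)) (P l) by rewrite -(lcycle_period lc) adj_sym.
  have ev' : adj (P (z - 1 + 1)) (P v) by rewrite subrK zf.
  have [i1 i2] : z - 1 + 2 <= l /\ v <= z - 1 + n%:Z by clear -hl hv vfn lz zf; position_lia.
  exact: (crossing_succ_succ bP i1 lv i2 al av el' ev').
(* As [P (f - 1)] is a neighbour of [x], its count is only known to be at least [deg x - k]: here
   [k < deg x] must be strict. *)
have c40 : (0 < cnt (succ_nbr x P (P (f - 1)%R)) (f + 1)%R (f + n%:Z)%R)%N.
  by clear -c4 kD; position_lia.
have [|v0 hv0 Vv0] := cnt_gt0 _ c40; first by clear -fh n3; position_lia.
have ml := Vin _ hv0 Vv0.
have c4' : (cnt (succ_nbr x P (P (f - 1)%R)) (f + 1) (f + n%:Z) <=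
    cnt (fun z => adj x (P (z - 1)%R)) (m + 1)%R (l + 1)%R)%N.
  have zero a b : f + 1 <= a -> a <= b -> b <= f + n%:Z -> b <= m + 1 \/ l + 1 <= a ->
      cnt (succ_nbr x P (P (f - 1))) a b = 0%N.
    move=> fa ab bf out; apply/eqP; rewrite -leqn0 leqNgt; apply/negP => /cnt_gt0 [//|r hr Vr].
    by have := Vin r _ Vr; position_lia.
  rewrite (@cnt_cat _ (f + 1) (m + 1)); try position_lia.
  rewrite (@cnt_cat _ (m + 1) (l + 1) (f + n%:Z)); try position_lia.
  rewrite (zero (f + 1)) ?(zero (l + 1)) ?addn0; try position_lia.
  by apply: cnt_le => [|r _ _ /andP[]]; first position_lia.
clear mmax hmax lmin Qlt Vin.
have b1 : (cnt (star_succ n x P) f (h + 1) <= cnt (fun z => adj x (P (z - 1)%R)) f (h + 1)%R)%N.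
  by apply: cnt_le => [|r _ _ /andP[]]; first position_lia.
have b2 : (cnt (star_pred n x P) l (z - 1 + n%:Z + 1) <=
    cnt (fun z => adj x (P (z + 1)%R)) l (z - 1 + n%:Z + 1)%R)%N.
  by apply: cnt_le => [|r _ _ /andP[]]; first position_lia.
have nz' : ~~ adj x (P (z - 1 + n%:Z)) by rewrite (lcycle_period lc).
have nl : ~~ adj x (P l) by apply: (succ_off_x bP).
have e1 := cnt_succ_pred (_ : l <= z - 1 + n%:Z) al at' nl nz'.
have {}e1 := e1 ltac:(position_lia).
have e2 := cnt_succ_pred (_ : f <= h) af ah nf nh.
have {}e2 := e2 ltac:(position_lia).
have e3 := cnt_succ_pred (_ : f <= m) af am nf nm.
have {}e3 := e3 ltac:(position_lia).
have fh1 : f <= h + 1 by position_lia.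
have hm1 : h + 1 <= m + 1 by position_lia.
have ml1 : m + 1 <= l + 1 by position_lia.
have lf : l + 1 <= f + n%:Z by position_lia.
have lz : l <= z - 1 + n%:Z + 1 by position_lia.
rewrite !(cnt_cat _ fh1 hm1) in e3.
have D1 := cnt_nbr bP (f - 1).
have {}D1 : cnt (fun z => adj x (P (z - 1))) f (f + n%:Z) = deg x.
  by rewrite (cnt_shift (fun w => adj x (P w))) -D1; congr cnt; position_lia.
rewrite (cnt_cat _ (le_trans fh1 hm1)) in D1; last position_lia.
rewrite (cnt_cat _ fh1 hm1) (cnt_cat _ ml1 lf) in D1.
have e4 : cnt (fun z => adj x (P (z - 1))) (l + 1) (f + n%:Z) =
    cnt (fun z => adj x (P (z - 1))) (l + 1) (z - 1 + n%:Z + 1).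
  have lfn : l + 1 <= f + n%:Z - 1 by position_lia.
  rewrite -{1}(subrK 1 (f + n%:Z)) (cnt_recr _ lfn) (_ : adj x _ = false) ?addn0.
    by congr cnt; position_lia.
  rewrite (_ : f + n%:Z - 1 - 1 = z - 1 + n%:Z); last position_lia.
  by rewrite (lcycle_period lc); apply: negbTE.
have e5 : cnt (fun z => adj x (P (z - 1))) l (z - 1 + n%:Z + 1) =
   (1 + cnt (fun z => adj x (P (z - 1)%R)) (l + 1)%R (z - 1 + n%:Z + 1)%R)%N.
  by rewrite cnt_recl ?al //; position_lia.
(* On the arcs ending at [h], [m], [l] and [z - 1 + n] the counts are at least [deg x + 2 - k],
   [deg x + 1 - k], [deg x - k] and [deg x + 2 - k]. Read as counts of successors, they overlap only
   at [l], so their sum is at most [deg x + 1]. *)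
clear -c1 c2 c3 c3' c4 c4' b1 b2 e1 e2 e3 D1 e4 e5; lia.
Qed.

End Alternation.

(** * Cycles without chords between successors and predecessors *)

Section Tough.
Variable G : sgraph.

Lemma connect_edgeless (T : finType) (e : rel T) u v :
  e =2 (fun _ _ => false) -> connect e u v = (u == v).
Proof.
move=> e0; apply/idP/eqP => [/connectP[[|w p] /=]|->]; last exact: connect0.
  by move=> _ ->.
by rewrite e0.
Qed.

Lemma delete_edgeless (S : {set G}) : independent (~: S) ->
  @adj (delete S) =2 (fun _ _ => false).
Proof.
move=> /forall_inP ind [u uS] [v vS] /=; apply/negbTE.
by rewrite /adj /= /induced_adj /=; have /forall_inP := ind u uS; apply.
Qed.

Lemma omega_edgeless (S : {set G}) : independent (~: S) -> omega (delete S) = #|~: S|.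
Proof.
move=> ind; rewrite /omega /n_comp_mem -[RHS]card_sig; apply: eq_card => u.
rewrite !inE andbT /roots /=; have := connect_root (@adj (delete S)) u.
by rewrite (connect_edgeless _ _ (delete_edgeless ind)) eq_sym.
Qed.

Lemma tough_independent (R : realFieldType) (S : {set G}) : tough (1 : R) G ->
  independent (~: S) -> (1 < #|~: S|)%N -> (#|~: S| <= #|S|)%N.
Proof.
move=> tG ind gt1; have := tG S; rewrite omega_edgeless // mul1r ler_nat; apply.
apply/negP => /forallP co; have [u [v [uS vS uv]]] : exists u v, [/\ u \in ~: S, v \in ~: S & u != v].
  by have /card_gt1P[u [v [? ? ?]]] := gt1; exists u, v.
have /forallP /(_ (Sub v vS)) := co (Sub u uS).
rewrite (connect_edgeless _ _ (delete_edgeless ind)) => /eqP /(congr1 val) /= E.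
by rewrite E eqxx in uv.
Qed.

End Tough.

Section EdgeSees.
Variables (G : sgraph) (k n : nat) (x : G).
Hypotheses (fr : induced_free (P2_kP1 k) G) (deg_x : (k <= deg x)%N).
Variables (P : int -> G) (bP : base P n x).
Let lc := base_lcycle bP.
Let n3 := lcycle_gt2 lc.

(** Otherwise the edge would miss all [deg x] successors, together with [x]. *)
Lemma edge_sees_succ (u v : G) : adj u v -> ~~ adj x u -> ~~ adj x v ->
  sees_succ n x P u || sees_succ n x P v.
Proof.
move=> e xu xv; apply: contraT; rewrite negb_or.
case/andP=> [/(sees_succP _ _ lc) su /(sees_succP _ _ lc) sv].
have : (cnt (fun z => adj x (P (z - 1)%R)) 0 (0 + n%:Z)%R + 1 < k)%N.
  apply: (cover_window_x fr bP e _ _ _ _ xu xv); [position_lia | position_lia | |].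
    by move=> z w _ _; apply: (succ_succ bP).
  move=> z _ az; rewrite (succ_off_x bP az) andbT; apply/andP; split; apply/negP => e'.
    by apply: su; exists z.
  by apply: sv; exists z.
have E : cnt (fun z => adj x (P (z - 1))) 0 (0 + n%:Z) = deg x.
  rewrite (cnt_shift (fun w => adj x (P w))) -(cnt_nbr bP (0 - 1)); congr cnt; clear; lia.
by rewrite E; move: deg_x; clear; lia.
Qed.

End EdgeSees.

Section NoStar.
Variables (G : sgraph) (k n : nat) (x : G).
Hypotheses (fr : induced_free (P2_kP1 k) G) (deg_x : (k <= deg x)%N).
Variables (P : int -> G) (bP : base P n x).
Hypothesis no_star : forall z, ~~ star_succ n x P z.
Implicit Types (B : int -> bool) (z w a b f h r q p : int) (u v y : G).
Let lc := base_lcycle bP.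
Let n3 := lcycle_gt2 lc.

Lemma succ_pred_free z w : adj x (P (z - 1)) -> adj x (P (w + 1)) -> ~~ adj (P z) (P w).
Proof.
move=> az aw; apply: contra (no_star z) => e; rewrite /star_succ az /=.
by apply/(sees_predP _ _ lc); exists w.
Qed.

(** Let [r] be the last predecessor seen from [P p]. The edge misses the successors up to [r] and
    the predecessors after [r], since each exception is a rerouting or contradicts the choice of
    [r]. Without stars this mixed set is independent. *)
Lemma no_crossing p : ~~ adj x (P p) -> ~~ adj x (P (p + 1)) ->
  sees_pred n x P (P p) -> sees_succ n x P (P (p + 1)) -> False.
Proof.
move=> np np1 /(sees_predP _ _ lc)[r1 ar1 er1] /(sees_succP _ _ lc)[q1 aq1 eq1].
have [r2 hr2 Er] := lcycle_reprP lc r1 p; have [q hq Eq] := lcycle_reprP lc q1 (p + 1).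
have aq : adj x (P (q - 1)) by rewrite Eq.
have eq : adj (P (p + 1)) (P q) by have := Eq 0; rewrite !addr0 => ->.
have ar2 : adj x (P (r2 + 1)) by rewrite Er.
have er2 : adj (P p) (P r2) by have := Er 0; rewrite !addr0 => ->.
have [|r [hr /andP[ar er] rmax]] := @cnt_max (pred_nbr x P (P p)) _ _ _ hr2.
  by apply/andP.
have rp : r != p by apply: contraTneq er => ->; rewrite adj_irrefl.
have qp : q != p + 1 by apply: contraTneq eq => ->; rewrite adj_irrefl.
have nr : ~~ adj x (P r) by apply: (pred_off_x bP).
have rq : r < q.
  have [//|qr] := ltrP r q; exfalso.
  have [i1 i2] : p + 2 <= q /\ r <= p + n%:Z - 1 by position_lia.
  exact: (crossing_pred_succ bP i1 qr i2 aq ar er eq).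
pose B z := if z <= r then adj x (P (z - 1)) else adj x (P (z + 1)).
have : (cnt B (p + 1) (p + 1 + n%:Z) + 1 < k)%N.
  have ep := lcycle_adj lc p.
  apply: (cover_window_x fr bP ep _ _ _ _ np np1); [position_lia | position_lia | |].
    move=> z w _ _; rewrite /B; case: ifP => _; case: ifP => _.
    - exact: (succ_succ bP).
    - exact: succ_pred_free.
    - by move=> az aw; rewrite adj_sym; apply: succ_pred_free.
    - exact: (pred_pred bP).
  move=> z hz; rewrite /B; case: ifP => zr az.
    have zp1 : z != p + 1 by apply: contraNneq np => zp1; rewrite zp1 addrK in az.
    have i1 : p + 2 <= z by position_lia.
    rewrite (succ_off_x bP az) andbT; apply/andP; split; apply/negP => e.
      have [i2 i3] : z < q /\ q <= p + n%:Z by position_lia.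
      exact: (crossing_succ_succ bP i1 i2 i3 az aq e eq).
    have i2 : r <= p + n%:Z - 1 by position_lia.
    exact: (crossing_pred_succ bP i1 zr i2 az ar er e).
  have zpn : z != p + n%:Z.
    by apply: contraNneq np1 => zpn; rewrite zpn addrAC (lcycle_period lc) in az.
  rewrite (pred_off_x bP az) andbT; apply/andP; split; apply/negP => e.
    have [i1 i2] : r < z /\ z < p + n%:Z by position_lia.
    by have := rmax z i1 i2; rewrite /pred_nbr az e.
  have [i1 i2 i3] : [/\ p < r, r < z & z <= p + n%:Z - 1] by split; position_lia.
  exact: (crossing_pred_pred bP i1 i2 i3 az ar er e).
have p1r : p + 1 <= r + 1 by position_lia.
have rp1 : r + 1 <= p + 1 + n%:Z by position_lia.
rewrite (cnt_cat _ p1r rp1).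
rewrite (@eq_cnt B (fun z => adj x (P (z - 1))) _ _ p1r); last first.
  by move=> z _ zr; rewrite /B ifT //; position_lia.
rewrite (@eq_cnt B (fun z => adj x (P (z + 1))) _ _ rp1); last first.
  by move=> z zr _; rewrite /B ifF //; position_lia.
have s1 : cnt (fun z => adj x (P (z - 1))) (p + 1) (r + 1) = cnt (fun w => adj x (P w)) p r.
  by rewrite (cnt_shift (fun w => adj x (P w))); congr cnt; position_lia.
have s2 : cnt (fun z => adj x (P (z + 1))) (r + 1) (p + 1 + n%:Z) =
    cnt (fun w => adj x (P w)) (r + 2) (p + 2 + n%:Z).
  by rewrite (cnt_shift (fun w => adj x (P w))); congr cnt; position_lia.
have s3 : deg x = (cnt (fun w => adj x (P w)) (p + 2)%R (r + 2)%R +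
    cnt (fun w => adj x (P w)) (r + 2)%R (p + 2 + n%:Z)%R)%N.
  by rewrite -(cnt_nbr bP (p + 2)); apply: cnt_cat; position_lia.
(* The two ranges differ only by the neighbour [P (r + 1)]; so [deg x - 1] vertices were collected,
   and [x] completes them to [deg x]. *)
have E : (cnt (fun w => adj x (P w)) p r + 1 = cnt (fun w => adj x (P w)) (p + 2)%R (r + 2)%R)%N.
  pose A w := adj x (P w); have i1 : p <= r by position_lia.
  have a1 : cnt A p (r + 2) = (A p + cnt A (p + 1)%R (r + 2)%R)%N.
    by apply: cnt_recl; position_lia.
  have a2 : cnt A (p + 1) (r + 2) = (A (p + 1)%R + cnt A (p + 1 + 1)%R (r + 2)%R)%N.
    by apply: cnt_recl; position_lia.
  have a3 : cnt A p (r + 2) = (cnt A p r + cnt A r (r + 2)%R)%N.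
    by apply: cnt_cat; position_lia.
  have a4 : cnt A r (r + 2) = (A r + cnt A (r + 1)%R (r + 2)%R)%N.
    by apply: cnt_recl; position_lia.
  have e1 : p + 1 + 1 = p + 2 by position_lia.
  have a5 : cnt A (r + 1) (r + 2) = A (r + 1) :> nat.
    by rewrite (_ : r + 2 = r + 1 + 1) ?cnt1 //; position_lia.
  move: a1 a2 a3 a4; rewrite a5 e1 /A (negbTE np) (negbTE np1) (negbTE nr) ar.
  by clear; lia.
rewrite s1 s2; move: E s3; clear -deg_x; lia.
Qed.

Lemma pred_free_succ z w : adj x (P (z + 1)) -> adj x (P (w - 1)) -> ~~ adj (P z) (P w).
Proof. by move=> az aw; rewrite adj_sym; apply: succ_pred_free. Qed.

End NoStar.

Section Blind.
Variables (G : sgraph) (k n : nat) (x : G).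
Hypotheses (fr : induced_free (P2_kP1 k) G) (k_gt0 : (0 < k)%N) (deg_x : (k <= deg x)%N).
Variables (P : int -> G) (bP : base P n x).
Hypothesis no_star : forall z, ~~ star_succ n x P z.
Implicit Types (z w p : int) (u v y : G).
Let lc := base_lcycle bP.
Let n3 := lcycle_gt2 lc.

Lemma edge_sees_pred u v : adj u v -> ~~ adj x u -> ~~ adj x v ->
  sees_pred n x P u || sees_pred n x P v.
Proof.
by move=> e xu xv; have := edge_sees_succ fr deg_x (base_opp bP) e xu xv; rewrite !sees_succ_opp.
Qed.

Definition blind v := [&& ~~ adj x v, ~~ sees_succ n x P v & ~~ sees_pred n x P v].

Lemma blind_indep u v : blind u -> blind v -> ~~ adj u v.
Proof.
case/and3P=> xu su _ /and3P[xv sv _]; apply/negP => e.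
by have := edge_sees_succ fr deg_x bP e xu xv; rewrite (negbTE su) (negbTE sv).
Qed.

Lemma blind_out v : (forall z, P z != v) -> blind v.
Proof.
move=> ov; apply/and3P; split; first by apply: (base_out bP) => //; apply: (base_off bP).
  by apply/(sees_succP _ _ lc) => -[z az]; apply/negP; apply: (succ_out fr deg_x bP).
rewrite -(sees_succ_opp _ _ lc).
apply/(sees_succP _ _ (lcycle_opp lc)) => -[z az]; apply/negP.
by apply: (succ_out fr deg_x (base_opp bP)).
Qed.

Lemma blind_succ z : adj x (P z) -> blind (P (z + 1)).
Proof.
rewrite -{1}(addrK 1 z) => az; apply/and3P; split; first exact: (succ_off_x bP).
  by apply/(sees_succP _ _ lc) => -[w aw]; apply/negP; apply: (succ_succ bP).
by apply/(sees_predP _ _ lc) => -[w aw]; apply/negP; apply: (succ_pred_free bP no_star).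
Qed.

(** If [P (p + 1)] is no neighbour of [x], it must see both kinds because [P p] sees neither;
    [no_crossing] on the next two edges then keeps [P (p + 2)] from seeing a successor or a
    predecessor. *)
Lemma blind_step p : blind (P p) ->
  adj x (P (p + 1)) \/ ~~ blind (P (p + 1)) /\ blind (P (p + 2)).
Proof.
case/and3P=> xp sp tp; case xp1: (adj x (P (p + 1))); [by left | right].
have ep z := lcycle_adj lc z; have nxp1 : ~~ adj x (P (p + 1)) by rewrite xp1.
have s1 : sees_succ n x P (P (p + 1)).
  by have := edge_sees_succ fr deg_x bP (ep p) xp nxp1; rewrite (negbTE sp).
have t1 : sees_pred n x P (P (p + 1)).
  by have := edge_sees_pred (ep p) xp nxp1; rewrite (negbTE tp).
split; first by rewrite /blind s1 andbF.
have p12 : p + 1 + 1 = p + 2 by rewrite -addrA.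
have nxp2 : ~~ adj x (P (p + 2)).
  apply/negP => xp2; case/(sees_succP _ _ lc): s1 => w aw; apply/negP.
  by apply: (pred_free_succ bP no_star) => //; rewrite p12.
have ns2 : ~~ sees_succ n x P (P (p + 2)).
  by apply/negP; rewrite -p12; apply: (no_crossing fr deg_x bP no_star); rewrite ?p12.
have nt2 : ~~ sees_pred n x P (P (p + 2)).
  apply/negP => t2; have nxp3 : ~~ adj x (P (p + 2 + 1)).
    apply/negP => xp3; case/(sees_predP _ _ lc): t2 => w aw; apply/negP.
    exact: (pred_pred bP).
  have := edge_sees_succ fr deg_x bP (ep (p + 2)) nxp2 nxp3; rewrite (negbTE ns2) /=.
  exact: (no_crossing fr deg_x bP no_star).
by apply/and3P.
Qed.

(** The pattern of a non-blind vertex followed by a blind one starts at each neighbour of [x] and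
    recurs two positions later, so from there on it occurs at one of any two consecutive
    positions. *)
Lemma blind_after_nonblind p : ~~ blind (P p) -> blind (P (p + 1)).
Proof.
pose I z := ~~ blind (P z) && blind (P (z + 1)).
have I_nbr z : adj x (P z) -> I z.
  by move=> az; apply/andP; split; [rewrite /blind az | apply: blind_succ].
have I2 z : I z -> I (z + 2).
  have e1 : z + 1 + 1 = z + 2 by rewrite -addrA.
  have e2 : z + 1 + 2 = z + 2 + 1 by rewrite -!addrA.
  case/andP=> _ /blind_step; rewrite e1 e2.
  by case=> [/I_nbr //|[? ?]]; apply/andP.
have [v xv] : exists v, adj x v.
  have : (0 < deg x)%N by lia.
  by move=> /card_gt0P[v]; rewrite inE => xv; exists v.
have [z0 Ez0] := base_onC bP xv; rewrite Ez0 in xv.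
have J z : z0 <= z -> I z || I (z - 1).
  move: z; apply: int_interval_ind => [|z _]; first by rewrite I_nbr.
  rewrite addrK => /orP[->|/I2]; first by rewrite orbT.
  by rewrite (_ : z - 1 + 2 = z + 1) => [->|]; last by rewrite -addrA.
have [w hw E] := lcycle_reprP lc p z0.
have := J w; rewrite /I subrK; have := E 0; rewrite !addr0 => ->; rewrite E.
case/andP: hw => -> _ /(_ isT) /orP[/andP[_ ->] //|/andP[_ ->]]; by [].
Qed.

Lemma no_star_absurd (R : realFieldType) : tough (1 : R) G -> False.
Proof.
move=> tG; pose N := [set v | ~~ blind v].
have NC : ~: N = [set v | blind v] by apply/setP => v; rewrite !inE negbK.
have bx : blind x by apply: blind_out; apply: (base_off bP).
have n0 : 0 <= n%:Z by lia.
have n0' : n%:Z <= 0 + n%:Z by lia.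
have cN : #|N| = cnt (fun z => ~~ blind (P z)) 0 n%:Z.
  rewrite -(card_window _ lc) //; apply: eq_card => v; rewrite inE.
  apply/idP/in_window => // [nv|[z [_ nz ->]] //].
  have [|ov] := boolP (v \in seg P 0 n%:Z).
    by move=> /mem_seg[] // z hz vz; exists z; rewrite -vz.
  case/negP: nv; apply: blind_out => z; apply: contraNneq ov => <-.
  have [w hw E] := lcycle_reprP lc z 0; apply/mem_seg => //; exists w; first by rewrite add0r in hw.
  by have := E 0; rewrite !addr0.
(* Each non-blind vertex is followed on the cycle by a blind one; the blind [x] off the cycle makes
   the inequality strict. *)
have ltNC : (#|N| < #|~: N|)%N.
  rewrite cN NC (cardsD1 x) inE bx add1n ltnS.
  apply: (@leq_trans (cnt (fun z => blind (P z)) 0 n%:Z)).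
    apply: (@leq_trans (cnt (fun z => blind (P (z + 1))) 0 n%:Z)).
      by apply: cnt_le => // z _ _; apply: blind_after_nonblind.
    rewrite (cnt_shift (fun z => blind (P z))) add0r [n%:Z + 1]addrC.
    rewrite (@cnt_period (fun z => blind (P z)) n 1 0) ?add0r // => z.
    by rewrite (lcycle_period lc).
  rewrite -(card_window _ lc) //; apply: subset_leq_card; apply/subsetP => v.
  by move=> /in_window[] // z [_ bz ->]; rewrite !inE bz andbT; apply: (base_off bP).
have ind : independent (~: N).
  by rewrite NC; apply: independentP => u v; rewrite !inE; apply: blind_indep.
have gt1 : (1 < #|~: N|)%N.
  have [p np] : exists p, ~~ blind (P p).
    have [b0|] := boolP (blind (P 0)); last by exists 0.
    exists 1; apply/negP => b1; have := blind_indep b0 b1.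
    by rewrite -[1]add0r (lcycle_adj lc).
  have : (0 < #|N|)%N by apply/card_gt0P; exists (P p); rewrite inE.
  by move: ltNC; lia.
by have := tough_independent tG ind gt1; lia.
Qed.

End Blind.

(** * The cubic case *)

Lemma deg3_nbrs (G : sgraph) (v a b c w : G) : (deg v <= 3)%N ->
  adj v a -> adj v b -> adj v c -> a != b -> a != c -> b != c -> adj v w ->
  w \in [:: a; b; c].
Proof.
move=> dv va vb vc ab ac bc vw; apply: contraLR dv; rewrite !inE !negb_or -ltnNge.
case/and3P=> wa wb wc; rewrite /deg.
have <- : #|[set w; a; b; c]| = 4%N.
  by rewrite -!setUA !cardsU1 cards1 !inE !negb_or wa wb wc ab ac bc.
apply: subset_leq_card; apply/subsetP => u; rewrite !inE.
by case/orP=> [/orP[/orP[]|]|] /eqP ->.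
Qed.

Lemma cnt_has (B : int -> bool) (a b z : int) : a <= z < b -> B z -> (0 < cnt B a b)%N.
Proof.
move=> /andP[az zb] Bz; rewrite (cnt_cat _ az (ltW zb)) (@cnt_recl _ z) // Bz.
by rewrite addnCA.
Qed.

Section PetersenCycle.
Variables (G : sgraph) (n : nat) (x : G) (P : int -> G).
Hypotheses (fr : induced_free (P2_kP1 3) G) (bP : base P n x) (deg_x : deg x = 3%N).
Hypotheses (deg_missed : forall v : G, missed n v -> (deg v <= 3)%N).
Hypotheses (deg_ge3 : forall v : G, (3 <= deg v)%N).
Variables (z0 : int) (st0 : star_succ n x P z0).
Implicit Types (z w f h : int).
Let lc := base_lcycle bP.
Let n3 := lcycle_gt2 lc.
Let per := lcycle_period lc.
Let k3 : (3 <= deg x)%N. Proof. by rewrite deg_x. Qed.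

(** For [k = deg x = 3], [star_lower_bounds] gives three starred successors, which is all of
    them. *)
Lemma all_star f : adj x (P (f - 1)) -> star_succ n x P f.
Proof.
move=> af; have [c1 _] := star_lower_bounds fr bP st0; rewrite deg_x in c1.
apply: contraT => nf; have [w hw E] := lcycle_reprP lc f 0.
have Ew : P w = P f by have := E 0; rewrite !addr0.
have n0 : 0 <= n%:Z by lia.
have := @cntID (fun z => sees_pred n x P (P z)) (fun z => adj x (P (z - 1))) 0 n%:Z n0.
have -> : cnt (fun z => adj x (P (z - 1))) 0 n%:Z = 3%N.
  rewrite -deg_x -(cnt_nbr bP (0 - 1)) (cnt_shift (fun w => adj x (P w))).
  by congr cnt; clear; lia.
have := @cnt_has (fun z => adj x (P (z - 1)) && ~~ sees_pred n x P (P z)) 0 n%:Z w.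
rewrite add0r in hw; rewrite hw E af Ew => /(_ isT).
move: nf; rewrite /star_succ af /= => nf /(_ nf) /=.
by move: c1; rewrite /star_succ; clear; lia.
Qed.

(** The last predecessor seen from [P f] is not at [f + 1]: the arc would hold one star where
    [count_star_last] requires two. The last clause is kept for [chord]. *)
Lemma star_far f : adj x (P (f - 1)) -> exists h,
  [/\ f + 1 < h < f + n%:Z - 1, adj x (P (h + 1)), adj (P f) (P h) &
    (0 < cnt (star_pred n x P) (h + 1) (f + n%:Z))%N].
Proof.
move=> af; have nf := succ_off_x bP af.
have [h [fh ah e hmax]] := star_succ_last lc (all_star af).
have [c1 c2] := count_star_last fr bP fh af ah e hmax; rewrite deg_x in c1 c2.
exists h; split=> //.
have hfn : h != f + n%:Z - 1.
  by apply: contraTneq (pred_off_x bP ah) => ->; rewrite addrAC per negbK.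
have hf1 : h != f + 1.
  apply: contraTneq c1 => ->; rewrite -ltnNge.
  rewrite (@cnt_recl _ f) ?(@cnt_recl _ (f + 1)) ?cnt_id; try by clear; lia.
  rewrite {2}/star_succ addrK (negbTE nf) /=.
  by case: (star_succ n x P f).
by position_lia.
Qed.

Lemma succ_nbrs f h (u : G) : adj x (P (f - 1)) -> f + 1 < h < f + n%:Z - 1 ->
  adj x (P (h + 1)) -> adj (P f) (P h) -> adj (P f) u ->
  u \in [:: P (f - 1); P (f + 1); P h].
Proof.
move=> af fh ah e; have nh := pred_off_x bP ah.
have nf1 : ~~ adj x (P (f + 1)) by apply: contraL e => af1; apply: (pred_pred bP).
apply: deg3_nbrs => //.
- by apply: deg_missed; apply: (succ_missed fr k3 bP).
- by rewrite adj_sym -{2}(subrK 1 f) (lcycle_adj lc).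
- exact: (lcycle_adj lc).
- by apply: contraNneq nf1 => <-.
- by apply: contraNneq nh => <-.
- apply/eqP => E; have := lcycle_inj lc _ _ E; clear -fh n3.
  by move=> h0; have := h0 _ _; lia.
Qed.

(** By [count_succ] another successor [P g] is adjacent to [P (f + 1)]. All neighbours of [P g] are
    its two cycle neighbours and one predecessor, so [P (f + 1)] is that predecessor. *)
Lemma nbr_add3 z : adj x (P z) -> adj x (P (z + 3)).
Proof.
move=> az; pose f := z + 1; have af : adj x (P (f - 1)) by rewrite addrK.
have [h [fh ah e _]] := star_far af.
have nf1 : ~~ adj x (P (f + 1)) by apply: contraL e => af1; apply: (pred_pred bP).
have := count_succ fr bP af (lcycle_adj lc f); rewrite deg_x nf1 => c1.
have c0 : (0 < cnt (succ_nbr x P (P (f + 1)%R)) (f + 1)%R (f + n%:Z)%R)%N.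
  by move: c1; clear; lia.
have [|g hg /andP[ag eg]] := cnt_gt0 _ c0; first by clear -n3; lia.
have [h' [fh' ah' e' _]] := star_far ag.
rewrite adj_sym in eg; have := succ_nbrs ag fh' ah' e' eg; rewrite !inE.
case/or3P=> /eqP E.
- by case/negP: nf1; rewrite E.
- have := lcycle_inj lc _ _ E; clear -hg => h0; have := h0 _ _; lia.
have := ah'; rewrite (_ : P (h' + 1) = P (f + 1 + 1)).
  by rewrite /f -!addrA.
have [w hw Ew] := lcycle_reprP lc h' (f + 1).
rewrite -Ew; congr P; congr (_ + _); have := Ew 0; rewrite !addr0 -E => /esym E0.
by apply/esym; apply: (lcycle_inj lc _ _ E0); case/andP: hw.
Qed.

Lemma not_nbr_add1 z : adj x (P z) -> ~~ adj x (P (z + 1)).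
Proof. exact: (nbr_not_consecutive bP). Qed.

Lemma not_nbr_add2 z : adj x (P z) -> ~~ adj x (P (z + 2)).
Proof.
move=> /nbr_add3 az3; apply/negP => az2; have := not_nbr_add1 az2.
by rewrite -addrA az3.
Qed.

Lemma length_cycle : n = 9%N.
Proof.
have [z az] : exists z, adj x (P z) by exists (z0 - 1); case/andP: st0.
have az3 := nbr_add3 az; have az6 := nbr_add3 az3; have az9 := nbr_add3 az6.
rewrite -!addrA in az6 az9.
have c9 : cnt (fun w => adj x (P w)) z (z + 9) = 3%N.
  have -> : z + 9 = z + 3 + 3 + 3 by clear; lia.
  have c3 w : adj x (P w) -> cnt (fun w => adj x (P w)) w (w + 3) = 1%N.
    move=> aw; have e1 : w + 3 = w + 1 + 1 + 1 by rewrite -!addrA.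
    rewrite e1 (@cnt_recl _ w) ?(@cnt_recl _ (w + 1)) ?cnt1; try by clear; lia.
    rewrite aw (negbTE (not_nbr_add1 aw)) -addrA.
    by rewrite (negbTE (not_nbr_add2 aw)).
  have le3 w : w <= w + 3 by clear; lia.
  rewrite (cnt_cat _ (le3 z) (le_trans (le3 _) (le3 _))) (cnt_cat _ (le3 _) (le3 _)) !c3 //.
  by rewrite -addrA.
have cn := cnt_nbr bP z; rewrite deg_x in cn.
have i9 : z <= z + 9 by clear; lia.
have [ltn9|gtn9|//] := ltngtP n 9.
  have azn : adj x (P (z + n%:Z)) by rewrite per.
  have i1 : z <= z + n%:Z by clear; lia.
  have i2 : z + n%:Z <= z + 9 by move: ltn9; clear; lia.
  have i3 : z + n%:Z <= z + n%:Z < z + 9 by move: ltn9; clear; lia.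
  have := @cnt_has (fun w => adj x (P w)) (z + n%:Z) (z + 9) _ i3 azn.
  rewrite (cnt_cat _ i1 i2) cn in c9.
  by rewrite -[in X in X -> _](ltn_add2l 3) c9.
have i2 : z + 9 <= z + n%:Z by move: gtn9; clear; lia.
have i3 : z + 9 <= z + 9 < z + n%:Z by move: gtn9; clear; lia.
have := @cnt_has (fun w => adj x (P w)) (z + 9) (z + n%:Z) _ i3 az9.
rewrite (cnt_cat _ i9 i2) c9 in cn.
by rewrite -[in X in X -> _](ltn_add2l 3) cn.
Qed.

(** The only predecessors in the range of [star_far] are at [z + 5] and [z + 8], and the latter
    would leave no room for the starred predecessor required after it. *)
Lemma chord z : adj x (P z) -> adj (P (z + 1)) (P (z + 5)).
Proof.
move=> az; have af : adj x (P (z + 1 - 1)) by rewrite addrK.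
have [h [fh ah e c0]] := star_far af; rewrite length_cycle in fh c0.
have az3 := nbr_add3 az; have az6 := nbr_add3 az3; have az9 := nbr_add3 az6.
rewrite -!addrA in az6 az9.
have := not_nbr_add1 az3; have := not_nbr_add2 az3; rewrite -!addrA => n5 n4.
have := not_nbr_add1 az6; have := not_nbr_add2 az6; rewrite -!addrA => n8 n7.
have [Eh|Eh] : h = z + 5 \/ h = z + 8.
  have [E|[E|[E|[E|[E|E]]]]] : h = z + 3 \/ h = z + 4 \/ h = z + 5 \/ h = z + 6 \/
     h = z + 7 \/ h = z + 8 by clear -fh; lia.
  - by move: ah; rewrite E -addrA (negbTE n4).
  - by move: ah; rewrite E -addrA (negbTE n5).
  - by left.
  - by move: ah; rewrite E -addrA (negbTE n7).
  - by move: ah; rewrite E -addrA (negbTE n8).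
  - by right.
  by rewrite -Eh.
have [|w hw /andP[aw _]] := cnt_gt0 _ c0; first by rewrite Eh; clear; lia.
have Ew : w = z + 9 by move: hw; rewrite Eh; clear; lia.
by have := not_nbr_add1 az9; rewrite -Ew aw.
Qed.

Let per9 w : P (w + 9) = P w.
Proof. by rewrite -[RHS]per length_cycle. Qed.

Lemma cycle_eq z i j : 0 <= i < 9 -> 0 <= j < 9 -> (P (z + i) == P (z + j)) = (i == j).
Proof.
move=> hi hj; apply/eqP/eqP => [E|-> //].
have [ij|ij] := leP i j.
  by have := lcycle_inj lc _ _ E; rewrite length_cycle; clear -hi hj ij => h; have := h _ _; lia.
have := lcycle_inj lc _ _ (esym E); rewrite length_cycle; clear -hi hj ij => h.
by have := h _ _; lia.
Qed.

Lemma adj_succ z u : adj x (P z) -> adj (P (z + 1)) u = (u \in [:: P z; P (z + 2); P (z + 5)]).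
Proof.
move=> az; have z0E : P z = P (z + 0) by rewrite addr0.
apply/idP/idP => [e|].
  apply: (deg3_nbrs _ _ _ _ _ _ _ e).
  - by apply: deg_missed; apply: (succ_missed fr k3 bP); rewrite addrK.
  - by rewrite adj_sym (lcycle_adj lc).
  - by have := lcycle_adj lc (z + 1); rewrite -addrA.
  - exact: chord.
  - by rewrite z0E cycle_eq.
  - by rewrite z0E cycle_eq.
  - by rewrite cycle_eq.
rewrite !inE => /or3P[] /eqP ->.
- by rewrite adj_sym (lcycle_adj lc).
- by have := lcycle_adj lc (z + 1); rewrite -addrA.
- exact: chord.
Qed.

Lemma adj_pred z u : adj x (P z) ->
  adj (P (z + 2)) u = (u \in [:: P (z + 1); P (z + 3); P (z + 7)]).
Proof.
move=> az; have az3 := nbr_add3 az; have az6 := nbr_add3 az3; rewrite -addrA in az6.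
have e1 : adj (P (z + 2)) (P (z + 1)).
  by have := lcycle_adj lc (z + 1); rewrite adj_sym -addrA.
have e3 : adj (P (z + 2)) (P (z + 3)) by have := lcycle_adj lc (z + 2); rewrite -addrA.
have e7 : adj (P (z + 2)) (P (z + 7)).
  by have := chord az6; rewrite adj_sym -!addrA -(per9 (z + 2)) -addrA.
apply/idP/idP => [e|]; last by rewrite !inE => /or3P[] /eqP ->.
apply: (deg3_nbrs _ e1 e3 e7 _ _ _ e); rewrite ?cycle_eq //.
by apply: deg_missed; apply: (pred_missed fr k3 bP); rewrite -addrA.
Qed.

(** The degree bound covers only missed vertices, and neighbours of [x] are not known to be missed.
    Instead, such an edge would yield a cycle through [x] and all nine vertices. *)
Lemma nbrs_indep z : adj x (P z) -> ~~ adj (P z) (P (z + 3)).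
Proof.
move=> az; have az3 := nbr_add3 az; have az6 := nbr_add3 az3; rewrite -addrA in az6.
apply/negP => e; have z0E : P z = P (z + 0) by rewrite addr0.
have ad := lcycle_adj lc.
have adE a b : b = a + 1 -> adj (P a) (P b) by move=> ->.
have e1 : adj (P (z + 6)) (P (z + 7)) by apply: adE; rewrite -addrA.
have e2 : adj (P (z + 7)) (P (z + 2)).
  by rewrite adj_sym adj_pred // !inE eqxx !orbT.
have e3 : adj (P (z + 2)) (P (z + 1)) by rewrite adj_pred // !inE eqxx.
have e4 := chord az.
have e5 : adj (P (z + 5)) (P (z + 4)) by rewrite adj_sym; apply: adE; rewrite -addrA.
have e6 : adj (P (z + 4)) (P (z + 8)) by have := chord az3; rewrite -!addrA.
have e7 : adj (P (z + 8)) (P z) by rewrite -(per9 z); apply: adE; rewrite -addrA.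
have a3 : adj (P (z + 3)) x by rewrite adj_sym.
apply: (base_absurd bP (a := z) (walk_cons (walk_cons (walk_cons (walk_cons (walk_cons
 (walk_cons (walk_cons (walk_cons (walk_cons (walk1 _) e6) e5) e4) e3) e2) e1) az6) a3) e)) => //.
rewrite length_cycle /seg (_ : absz (z + 9%N%:Z - z)%R = 9%N); last by clear; lia.
rewrite /= addr0; apply/permP => b /=.
(* Truth values become arbitrary numbers, to spare [lia] the case splits. *)
by do ?[move: (nat_of_bool _) => ?]; clear; lia.
Qed.

Lemma nbr_cases z w : adj x (P z) -> [|| adj x (P w), adj x (P (w - 1)) | adj x (P (w + 1))].
Proof.
move=> az; have az3 := nbr_add3 az; have az6 := nbr_add3 az3; have az9 := nbr_add3 az6.
rewrite -!addrA in az6 az9.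
have [w' hw E] := lcycle_reprP lc w z; rewrite length_cycle in hw.
have := E 0; rewrite !addr0 => <-; rewrite -!E.
have [h|[h|h]] : (w' = z \/ w' = z + 3 \/ w' = z + 6) \/
    (w' - 1 = z \/ w' - 1 = z + 3 \/ w' - 1 = z + 6) \/
    (w' + 1 = z + 3 \/ w' + 1 = z + 6 \/ w' + 1 = z + 9) by clear -hw; lia.
- by apply/orP; left; case: h => [|[]] ->.
- by apply/orP; right; apply/orP; left; case: h => [|[]] ->.
- by apply/orP; right; apply/orP; right; case: h => [|[]] ->.
Qed.

Lemma adj_x z u : adj x (P z) -> adj x u = (u \in [:: P z; P (z + 3); P (z + 6)]).
Proof.
move=> az; have az3 := nbr_add3 az; have az6 := nbr_add3 az3; rewrite -addrA in az6.
have z0E : P z = P (z + 0) by rewrite addr0.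
apply/idP/idP => [e|]; last by rewrite !inE => /or3P[] /eqP ->.
by apply: (deg3_nbrs _ az az3 az6 _ _ _ e); rewrite ?deg_x // ?z0E cycle_eq.
Qed.

(** The neighbours of [y] are on the cycle but are neither successors nor predecessors, so they are
    the three neighbours of [x]. The twins [x] and [y] then fit together into a cycle of length
    eleven. *)
Lemma off_cycle_x y : (forall w, P w != y) -> y = x.
Proof.
have [z az] : exists z, adj x (P z) by exists (z0 - 1); case/andP: st0.
move=> oy; apply/eqP; apply: contraT => yx.
have az3 := nbr_add3 az; have az6 := nbr_add3 az3; rewrite -addrA in az6.
have oyN w : P (- w) != y by [].
have sub : [set u | adj y u] \subset [set u | adj x u].
  apply/subsetP => u; rewrite !inE => yu.
  have [|nu] := boolP (u \in seg P 0 n%:Z); last first.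
    suff ou w : P w != u by have := base_out bP oy ou; rewrite yu.
    apply: contraNneq nu => <-; have [w' hw E] := lcycle_reprP lc w 0.
    by apply/mem_seg; [lia | exists w'; [lia | have := E 0; rewrite !addr0]].
  case/mem_seg=> // w _ uE; rewrite {}uE in yu *.
  case/or3P: (nbr_cases w az) => // aw.
    by have := succ_out fr k3 bP oy aw; rewrite yu.
  have := succ_out fr k3 (base_opp bP) oyN (z := - w).
  by rewrite opprK yu opprD opprK => /(_ aw).
have Exy : [set u | adj y u] = [set u | adj x u].
  by apply/eqP; rewrite eqEcard sub; have := deg_ge3 y; rewrite -deg_x.
have yE u : adj y u = adj x u by have := congr1 (fun S : {set G} => u \in S) Exy; rewrite !inE.
have ad := lcycle_adj lc.
have adE a b : b = a + 1 -> adj (P a) (P b) by move=> ->.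
have e1 : adj (P (z + 6)) (P (z + 7)) by apply: adE; rewrite -addrA.
have e2 : adj (P (z + 7)) (P (z + 2)).
  by rewrite adj_sym adj_pred // !inE eqxx !orbT.
have e3 : adj (P (z + 2)) (P (z + 1)) by rewrite adj_pred // !inE eqxx.
have e4 := chord az.
have e5 : adj (P (z + 5)) (P (z + 4)) by rewrite adj_sym; apply: adE; rewrite -addrA.
have e6 : adj (P (z + 4)) (P (z + 8)) by have := chord az3; rewrite -!addrA.
have e7 : adj (P (z + 8)) (P z) by rewrite -(per9 z); apply: adE; rewrite -addrA.
have a0 : adj (P z) x by rewrite adj_sym.
have a3 : adj (P (z + 3)) y by rewrite adj_sym yE.
have a6 : adj y (P (z + 6)) by rewrite yE.
exfalso; apply: (@lcycle_absurd _ _ _ lc z [:: x; y] _ _ _ (walk_cons (walk_cons (walk_cons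
  (walk_cons (walk_cons (walk_cons (walk_cons (walk_cons (walk_cons (walk_cons (walk1 _)
  e6) e5) e4) e3) e2) e1) a6) a3) az3) a0)) => //.
- by rewrite /= inE andbT eq_sym.
- by move=> v; rewrite !inE => /orP[] /eqP -> // w; apply: (base_off bP).
rewrite length_cycle /seg (_ : absz (z + 9%N%:Z - z)%R = 9%N); last by clear; lia.
rewrite /= addr0; apply/permP => b /=.
by do ?[move: (nat_of_bool _) => ?]; clear; lia.
Qed.

Lemma cycle_petersen : iso G petersen.
Proof.
have [z az] : exists z, adj x (P z) by exists (z0 - 1); case/andP: st0.
have az3 := nbr_add3 az; have az6 := nbr_add3 az3; rewrite -addrA in az6.
pose q (i : nat) : G := if (i < 9)%N then P (z + i%:Z) else x.
have q_inj (i j : 'I_10) : q i = q j -> i = j.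
  rewrite /q; case: ltnP => i9; case: ltnP => j9.
  - by move/eqP; rewrite cycle_eq // => /eqP [] /val_inj.
  - by move/eqP; rewrite (negbTE (base_off bP _)).
  - by move/esym/eqP; rewrite (negbTE (base_off bP _)).
  - by move=> _; apply/val_inj => /=; move: (ltn_ord i) (ltn_ord j) i9 j9; clear; lia.
(* The indices 0, 3, 6 are the neighbours of [x]: their entries follow by symmetry from the other
   rows, and among themselves from [nbrs_indep]. *)
have rows i : (i < 10)%N -> i \notin [:: 0; 3; 6]%N ->
    forall u, adj (q i) u = (u \in map q (pet_nbrs i)).
  case: i => [|[|[|[|[|[|[|[|[|[|i]]]]]]]]]] // _ _ u.
  - by rewrite /q /= addr0; apply: adj_succ.
  - exact: adj_pred.
  - by have := adj_succ u az3; rewrite -!addrA.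
  - by rewrite /q /= -(per9 (z + 1%N)); have := adj_pred u az3; rewrite -!addrA.
  - by rewrite /q /= -(per9 (z + 2%N)); have := adj_succ u az6; rewrite -!addrA.
  - rewrite /q /= -(per9 (z + 0%N)) -(per9 (z + 4%N)); have := adj_pred u az6.
    by rewrite -!addrA.
  - by rewrite /q /= addr0; apply: adj_x.
have memq (i j : 'I_10) : (q j \in map q (pet_nbrs i)) = ((j : nat) \in pet_nbrs i).
  apply/mapP/idP => [[m mi jm]|ji]; last by exists (j : nat).
  suff m10 : (m < 10)%N by have -> : j = Ordinal m10 by apply: q_inj.
  exact: (allP (@pet_check (fun i _ => all (fun m => (m < 10)%N) (pet_nbrs i)) isT i i)).
apply: (iso_petersen (q := fun i => q i)) => //.
- move=> v; have [nv|] := boolP (v \in seg P z (z + 9)); last first.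
    move=> nv; exists ord_max; rewrite /q /=; apply: off_cycle_x => w.
    apply: contraNneq nv => <-; have [w' hw E] := lcycle_reprP lc w z.
    have := E 0; rewrite !addr0 => <-; apply/mem_seg; first by clear; lia.
    by exists w'; rewrite // -[9]/(9%:Z) -length_cycle.
  case/mem_seg: nv => [|w hw ->]; first by clear; lia.
  have w10 : (`|(w - z)%R| < 10)%N by clear -hw; lia.
  exists (Ordinal w10); rewrite /q /= ifT; last by clear -hw; lia.
  by congr P; clear -hw; lia.
have pet_sym (i j : 'I_10) : ((i : nat) \in pet_nbrs j) = ((j : nat) \in pet_nbrs i).
  by apply/eqP; move: i j; exact: (@pet_check (fun i j => (i \in pet_nbrs j) == (j \in pet_nbrs i))).
move=> i j.
have [iA|/rows ->] := boolP ((i : nat) \in [:: 0; 3; 6]%N) => //.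
have [jA|/rows] := boolP ((j : nat) \in [:: 0; 3; 6]%N); last first.
  by rewrite adj_sym => -> //; rewrite memq pet_sym.
have -> : ((j : nat) \in pet_nbrs i) = false.
  by move: jA; rewrite !inE => /or3P[] /eqP ->; move: iA; rewrite !inE => /or3P[] /eqP ->.
have n03 := nbrs_indep az; have n36 := nbrs_indep az3; have n69 := nbrs_indep az6.
have z0E : P (z + 0%:Z) = P z by rewrite addr0.
rewrite -!addrA per9 in n36 n69; rewrite /q.
move: jA; rewrite !inE => /or3P[] /eqP ->; move: iA; rewrite !inE => /or3P[] /eqP -> /=;
  rewrite ?adj_irrefl ?z0E //; apply/negbTE; rewrite // adj_sym //.
Qed.

End PetersenCycle.

(** * Consequences of connectivity *)

Section Connectivity.
Variables (G : sgraph) (k : nat).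
Hypothesis kG : kconnected k G.
Implicit Types (S C : {set G}) (u v : G).

Lemma delete_closed S C u v : (#|S| < k)%N -> u \in C -> u \notin S -> v \notin S ->
  (forall a b, a \in C -> b \notin S -> adj a b -> b \in C) -> v \in C.
Proof.
move=> Sk uC uS vS cl; have [_ /(_ _ Sk) /forallP co] := kG.
have uS' : u \in ~: S by rewrite inE.
have vS' : v \in ~: S by rewrite inE.
have /forallP /(_ (Sub v vS')) /connectP[p] := co (Sub u uS').
have: val (Sub u uS' : {w | w \in ~: S}) \in C by [].
move: (Sub u uS') => w wC pth /(congr1 val) /= ->.
elim: p w wC pth => //= a p IHp w wC /andP[wa]; apply: IHp.
by apply: cl wa => //; have := valP a; rewrite inE.
Qed.

(** Fewer than [k] neighbours would separate [v] from some further vertex, which exists because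
    [k < #|G|]. *)
Lemma kconnected_deg v : (k <= deg v)%N.
Proof.
rewrite leqNgt; apply/negP => dk; have [kn _] := kG.
have [w] : exists w, w \notin v |: [set u | adj v u].
  apply/existsP; apply: contraLR kn; rewrite negb_exists => /forallP all_in.
  rewrite -leqNgt; apply: leq_trans dk.
  have -> : #|G| = #|v |: [set u | adj v u]|.
    by apply: eq_card => u; have := all_in u; rewrite negbK => ->.
  by rewrite cardsU1 inE adj_irrefl.
rewrite !inE negb_or => /andP[wv nw].
have := @delete_closed [set u | adj v u] [set v] v w dk; rewrite !inE (negbTE wv).
move=> cl; suff: false by []; apply: cl => //; first by rewrite adj_irrefl.
by move=> a b /set1P ->; rewrite inE => /negbTE ->.
Qed.

(** Two neighbours of a vertex [v] are joined by a path avoiding [v], which closes through [v]. *)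
Lemma kconnected_cycle : (2 <= k)%N -> exists c : seq G, ucycle adj c /\ (2 < size c)%N.
Proof.
move=> k2; have [kn co] := kG.
have [v _] : exists v, v \in G by apply/card_gt0P; apply: leq_ltn_trans kn.
have /card_gt1P[a [b [va vb ab]]] := leq_trans k2 (kconnected_deg v).
rewrite !inE in va vb.
have nv u : adj v u -> u \in ~: [set v].
  by move=> vu; rewrite !inE; apply: contraTneq vu => ->; rewrite adj_irrefl.
pose a' : delete [set v] := Sub a (nv a va); pose b' : delete [set v] := Sub b (nv b vb).
have /forallP /(_ a') /forallP /(_ b') : connected (delete [set v]) by apply: co; rewrite cards1.
case/connectP=> p0 pth0 E0; case/shortenP: pth0 E0 => p pth up _ E.
have la : last (val a') (map val p) = b by rewrite last_map -E.
exists (v :: map val (a' :: p)); split; last first.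
  by case: p la {E pth up} => [/= E|//]; rewrite E eqxx in ab.
apply/andP; split; last first.
  rewrite cons_uniq map_inj_uniq ?up ?andbT; last exact: val_inj.
  by apply/mapP=> -[w _ E1]; have := valP w; rewrite -E1 !inE eqxx.
have pval (w : delete [set v]) r : path adj w r -> path adj (val w) (map val r).
  by elim: r w => //= u r IHr w /andP[wu /IHr ->]; rewrite andbT.
by have := pval _ _ pth; rewrite /= rcons_path la va adj_sym vb => ->.
Qed.

End Connectivity.

Section OffCycle.
Variables (G : sgraph) (k n : nat) (P : int -> G).
Hypotheses (kG : kconnected k G) (fr : induced_free (P2_kP1 k) G) (lc : lcycle P n).
Implicit Types (u v h : G) (z w : int).
Let n3 := lcycle_gt2 lc.
Let per := lcycle_period lc.

Let off v := v \notin seg P 0 n%:Z.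

Let offP v : reflect (forall z, P z != v) (off v).
Proof.
apply: (iffP idP) => [ov z|ov].
  apply: contraNneq ov => <-; have [w hw E] := lcycle_reprP lc z 0.
  by apply/mem_seg; [lia | exists w; [lia | have := E 0; rewrite !addr0]].
by apply/negP => /mem_seg[] // z _ E; have := ov z; rewrite E eqxx.
Qed.

Let off_adj u v := [&& off u, off v & adj u v].

Let off_connector u v : off u -> connect off_adj u v ->
  exists q, [/\ walk u v q, uniq q & {in q, forall v z, P z != v}].
Proof.
move=> ou /connectP[p0 pth0 ->]; case/shortenP: pth0 => p pth up _.
exists (u :: p); split=> //.
  by exists p; split=> //; apply: sub_path pth => a b /and3P[].
move=> b bp; apply/offP; move: bp; rewrite inE => /orP[/eqP -> //|].
elim: p u {ou up} pth => //= a p IHp u /andP[/and3P[_ oa _] pth].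
by rewrite inE => /orP[/eqP -> //|]; apply: IHp pth.
Qed.

(** Let [H] be the component of [u] off the cycle. By connectivity at least [k] cycle vertices are
    attached to [H]; their successors are independent and not adjacent to [H], so the edge from [u]
    to [v] would miss all of them. *)
Lemma off_cycle_indep u v : (forall z, P z != u) -> (forall z, P z != v) -> ~~ adj u v.
Proof.
move=> /offP ou /offP ov; apply/negP => uv.
pose H := [set v | connect off_adj u v].
have offH a : a \in H -> off a.
  rewrite inE => /connectP[p pth ->]; clear -pth ou; elim: p (u) ou pth => //= b p IHp c oc.
  by case/andP=> /and3P[_ oa _]; apply: IHp.
have sym : connect_sym off_adj.
  by apply: sym_connect_sym => a b; rewrite /off_adj andbCA adj_sym.
have connH a b : a \in H -> b \in H -> connect off_adj a b.
  by rewrite !inE => ua ub; rewrite sym in ua; apply: connect_trans ua ub.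
have closH a b : a \in H -> off b -> adj a b -> b \in H.
  move=> aH ob ab; move: (aH); rewrite !inE => ua; apply: connect_trans ua (connect1 _).
  by rewrite /off_adj (offH _ aH) ob.
have uH : u \in H by rewrite inE connect0.
have vH : v \in H by apply: closH uv.
pose B z := [exists h in H, adj h (P z)].
have perB z : B (z + n%:Z) = B z by rewrite /B per.
have BP z h : h \in H -> adj h (P z) -> B z by move=> hH e; apply/exists_inP; exists h.
have no_consec z : B z -> ~~ B (z + 1).
  move=> /exists_inP[a aH ea]; apply/negP => /exists_inP[b bH eb].
  have [q [wq uq oq]] := off_connector (offH _ aH) (connH _ _ aH bH).
  exact: (detour_consecutive lc wq uq oq ea eb).
have no_cross z w : z < w < z + n%:Z -> B z -> B w -> ~~ adj (P (z + 1)) (P (w + 1)).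
  move=> zw /exists_inP[a aH ea] /exists_inP[b bH eb]; apply/negP => e.
  have [q [wq uq oq]] := off_connector (offH _ aH) (connH _ _ aH bH).
  exact: (detour_crossing lc wq uq oq zw ea eb e).
have n0 : 0 <= n%:Z by [].
have cB : (k <= cnt B 0 n%:Z)%N.
  rewrite -(card_window _ lc) // ?add0r // leqNgt; apply/negP => lt.
  (* Attached positions are never consecutive, so some cycle vertex is unattached; fewer than [k]
     attached ones would separate it from [H]. *)
  have [z zN] : exists z, P z \notin window P B 0 n%:Z.
    have winB w : P w \in window P B 0 n%:Z -> B w.
      by case/in_window=> // z [_ Bz E]; rewrite /B E.
    have [P0|P0] := boolP (P 0 \in window P B 0 n%:Z); last by exists 0.
    by exists (0 + 1); apply: contra (no_consec _ (winB _ P0)); apply: winB.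
  have : P z \in H.
    apply: (delete_closed kG lt uH _ zN).
      apply/negP => /in_window[] // w [_ _ E]; have /offP /(_ w) := ou.
      by rewrite E eqxx.
    move=> a b aH bN ab; apply: (closH _ _ aH _ ab); apply: contraR bN; rewrite negbK.
    case/mem_seg=> // w hw E; apply/in_window => //; exists w; split=> //.
    by apply: (BP _ _ aH); rewrite -E.
  by move=> /offH /offP /(_ z); rewrite eqxx.
have : (#|window P (fun z => B (z - 1)%R) 0 n%:Z| < k)%N.
  apply: (edge_cover fr uv).
    apply: independentP => a b /in_window[] // z [hz Bz ->] /in_window[] // w [hw Bw ->].
    wlog zw : z w hz hw Bz Bw / z <= w.
      by case: (lerP z w) => [|/ltW] zw W; [apply: W zw | rewrite adj_sym; apply: W zw].
    have [->|zw1] := eqVneq w z; first by rewrite adj_irrefl.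
    rewrite -[in P z](subrK 1 z) -[in P w](subrK 1 w); apply: no_cross => //.
    by clear -hz hw zw zw1; lia.
  move=> a /in_window[] // z [hz Bz ->].
  have := no_consec _ Bz; rewrite subrK => nB.
  by apply/andP; split; apply: contra nB; apply: BP.
rewrite (card_window _ lc) // ?add0r // (cnt_shift B) (addrC n%:Z) sub0r (@cnt_period B n _ 0) // add0r.
by rewrite ltnNge cB.
Qed.
End OffCycle.

Lemma lcycle_of_ucycle (G : sgraph) (c : seq G) : ucycle adj c -> (2 < size c)%N ->
  (forall d : seq G, ucycle adj d -> (2 < size d)%N -> (size d <= size c)%N) ->
  exists P : int -> G, lcycle P (size c) /\ forall z, P z \in c.
Proof.
case: c => // x0 c /andP[cyc un] s3 mx; set n := size (x0 :: c).
pose P (z : int) := nth x0 (x0 :: c) `|(z %% n%:Z)%Z|.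
have n0 : n%:Z != 0 by [].
have lt z : (`|(z %% n%:Z)%Z| < n)%N.
  by have := modz_ge0 z n0; have := ltz_pmod z (_ : 0 < n%:Z); rewrite /n; lia.
exists P; split; last by move=> z; apply: mem_nth.
split=> //.
- by move=> z; rewrite /P modzDr.
- move=> z w zw wz /eqP; rewrite nth_uniq // => /eqP E.
  have /eqP : (z %% n%:Z)%Z = (w %% n%:Z)%Z.
    by rewrite -(gez0_abs (modz_ge0 z n0)) -(gez0_abs (modz_ge0 w n0)) E.
  rewrite eqz_mod_dvd => /dvdzP[t Et].
  have N0 : 0 < n%:Z by [].
  move: n%:Z N0 zw wz Et => N; clear=> N0 zw wz Et.
  have [t0|t0] : t <= -1 \/ 0 <= t by lia.
    have : 0 <= (-1 - t) * N by rewrite mulr_ge0 ?subr_ge0 // ltW.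
    rewrite mulrBl; lia.
  have : 0 <= t * N by rewrite mulr_ge0 // ltW.
  lia.
- move=> z; have := cyc; rewrite /= => /(pathP x0) /(_ `|(z %% n%:Z)%Z|%N).
  rewrite size_rcons -rcons_cons nth_rcons lt => /(_ isT); rewrite nth_rcons -/(P z).
  have := divz_eq z n%:Z; have := modz_ge0 z n0; have := lt z; set m := (z %% n%:Z)%Z.
  set q := (z %/ n%:Z)%Z => mn m0 zE.
  have mE i t : 0 <= i < n%:Z -> z + 1 = t * n%:Z + i -> P (z + 1) = nth x0 (x0 :: c) `|i|%N.
    by move=> hi e; rewrite /P e modzMDl modz_small.
  have [mc|mc] := ltnP `|m|%N (size c).
    rewrite (mE (m + 1) q); last by rewrite addrA -zE.
      by rewrite (_ : absz (m + 1)%R = (absz m).+1) //; clear -m0; lia.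
    by rewrite /n /=; clear -m0 mc; lia.
  rewrite (mE 0 (q + 1)) //; first by rewrite if_same.
  have nm : n%:Z = m + 1 by move: mn; rewrite /n /=; clear -m0 mc; lia.
  by rewrite mulrDl mul1r addr0 [X in _ = _ + X]nm addrA -zE.
Qed.

Local Close Scope ring_scope.

Lemma base_or_hamiltonian (G : sgraph) (k : nat) : 2 <= k -> kconnected k G ->
  induced_free (P2_kP1 k) G ->
  hamiltonian G \/ exists n (P : int -> G) x,
    base P n x /\ forall v : G, missed n v -> deg v <= deg x.
Proof.
move=> k2 kG fr; pose long m := [exists c : m.-tuple G, [&& 2 < m, cycle adj c & uniq c]].
have longI (c : seq G) : ucycle adj c -> 2 < size c -> long (size c).
  by move=> /andP[cyc un] s3; apply/existsP; exists (in_tuple c); rewrite s3 cyc.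
have exlong : exists m, long m.
  by have [c [uc s3]] := kconnected_cycle kG k2; exists (size c); apply: longI.
have lelong m : long m -> m <= #|G|.
  by case/existsP=> c /and3P[_ _ /card_uniqP E]; rewrite -(size_tuple c) -E max_card.
have [n /existsP[c0 /and3P[n3 cyc0 un0]] nmax] := ex_maxnP exlong lelong.
have maxn (d : seq G) : ucycle adj d -> 2 < size d -> size d <= n.
  by move=> ud sd; apply: nmax; apply: longI.
(* A boolean form of [missed] allows [x] to be chosen first, of maximal degree; any longest cycle
   missing [x] then serves. *)
pose missb v := [exists c : n.-tuple G, [&& cycle adj c, uniq c & v \notin c]].
have missP v : reflect (missed n v) (missb v).
  apply: (iffP existsP) => [[c /and3P[cyc un nv]]|[c [/andP[cyc un] sc nv]]].
    by exists c; rewrite size_tuple; split=> //; apply/andP.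
  by have cs : size c == n by [apply/eqP]; exists (Tuple cs); rewrite /= cyc un.
have [all_in|] := boolP [forall v, v \in c0].
  left; exists c0; rewrite size_tuple; split=> //; first by apply/andP.
  exact/forallP.
rewrite negb_forall => /existsP[v0 nv0]; right.
have mv0 : missb v0 by apply/existsP; exists c0; rewrite cyc0 un0.
case: (arg_maxnP (fun v => deg v) mv0) => x /missP[c [uc sc nx]] xmax.
have [P [lc Pin]] : exists P : int -> G, lcycle P n /\ forall z, P z \in c.
  by rewrite -sc; apply: lcycle_of_ucycle; rewrite ?sc.
exists n, P, x; split; last by move=> v /missP /xmax.
split=> // [z|u v ou ov]; first by apply: contraNneq nx => <-.
exact: (off_cycle_indep kG fr lc).
Qed.

(** * Essential independent sets *)

Lemma dist_two (G : sgraph) (x y c : G) : x != y -> ~~ adj x y -> adj x c -> adj c y ->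
  dist x y = Some 2.
Proof.
move=> xy nxy xc cy; rewrite /dist.
(* Three distinct vertices put the length 2 into the range searched by [dist]. *)
have cxy : [/\ x != c, c != y & 2 < #|G|].
  have xc' : x != c by apply: contraTneq xc => ->; rewrite adj_irrefl.
  have cy' : c != y by apply: contraTneq cy => ->; rewrite adj_irrefl.
  split=> //; have /card_uniqP E : uniq [:: x; c; y] by rewrite /= !inE negb_or xc' xy cy'.
  by rewrite -[3]E max_card.
have [xc' cy' G3] := cxy.
have h0 : has_path 0 x y = false.
  by apply/existsP => -[p]; rewrite tuple0 /= (negbTE xy).
have h1 : has_path 1 x y = false.
  apply/existsP => -[p]; case: (tupleP p) => a q; rewrite tuple0 /= => /and3P[xa _ /eqP E].
  by move: xa; rewrite E (negbTE nxy).
have h2 : has_path 2 x y.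
  apply/existsP; exists [tuple c; y]; rewrite /= !inE xc cy eqxx.
  by rewrite negb_or xc' xy cy'.
by case: #|G| G3 => [|[|[|m]]] //= _; rewrite h0 h1 h2.
Qed.

Lemma mu_le (R : realFieldType) (G : sgraph) (k : nat) (S : {set G}) (a : \bar R) :
  essential k S -> (a <= mu R k G)%E -> (a <= ((\max_(x in S) deg x)%:R%:E))%E.
Proof.
move=> eS; have kn : k < #|G|.+1.
  by case/existsP: eS => x /and4P[_ /eqP <- _ _]; rewrite ltnS max_card.
have ka : k <= alpha_e G.
  apply: (@leq_bigmax_cond _ (fun k : 'I_#|G|.+1 => [exists S : {set G}, essential k S])
    (fun k => k : nat) (Ordinal kn)).
  by apply/existsP; exists S.
rewrite /mu ka => /le_trans; apply.
exact: (bigmin_le_cond _ _ eS).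
Qed.

Lemma base_mu_bound (R : realFieldType) (G : sgraph) (k n : nat) (P : int -> G) (x : G) :
  induced_free (P2_kP1 k) G -> base P n x -> k <= deg x ->
  (forall v : G, missed n v -> deg v <= deg x) ->
  (((7 * k%:R - 6) / 5)%R%:E <= mu R k.+1 G)%E -> 7 * k <= 5 * deg x + 6.
Proof.
move=> fr bP kD xmax mub; have lc := base_lcycle bP.
pose W := window P (fun z => adj x (P (z - 1)%R)) 0 n%:Z.
have WP v : v \in W -> exists2 z, adj x (P (z - 1)%R) & v = P z.
  by case/in_window=> // z [_ az ->]; exists z.
have cW : #|W| = deg x.
  rewrite /W (card_window _ lc) ?add0r // -(cnt_nbr bP (0 - 1)%R).
  by rewrite (cnt_shift (fun w => adj x (P w))); congr cnt; clear; lia.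
pose S := x |: [set:: take k (enum W)].
have subW v : v \in [set:: take k (enum W)] -> v \in W.
  by rewrite inE => /mem_take; rewrite mem_enum.
have xW : x \notin [set:: take k (enum W)].
  by apply/negP => /subW /WP[z _ E]; have := base_off bP z; rewrite -E eqxx.
have cS : #|S| = k.+1.
  rewrite cardsU1 xW add1n; congr _.+1.
  rewrite cardsE; have /card_uniqP -> := take_uniq k (enum_uniq W).
  by rewrite size_take -cardE cW; case: ltngtP kD.
have eS : essential k.+1 S.
  apply/existsP; exists x; rewrite /essential_center cS eqxx setU11 /=.
  apply/andP; split.
    apply: independentP => u v /setU1P[->|/subW/WP[z az ->]] /setU1P[->|/subW/WP[w aw ->]].
    - by rewrite adj_irrefl.
    - exact: (succ_off_x bP).
    - by rewrite adj_sym; apply: (succ_off_x bP).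
    - exact: (succ_succ bP).
  apply/forall_inP => v; rewrite !inE => /andP[vx /orP[/eqP vE|vW]].
    by rewrite vE eqxx in vx.
  have [|z az vE] := WP v; first by apply: subW; rewrite inE.
  rewrite {}vE in vx *; apply/eqP; apply: (dist_two _ _ az).
  - by rewrite eq_sym.
  - exact: (succ_off_x bP).
  - by have := lcycle_adj lc (z - 1)%R; rewrite subrK.
have maxS : \max_(v in S) deg v <= deg x.
  apply/bigmax_leqP => v /setU1P[->//|/subW/WP[z az ->]].
  by apply: xmax; apply: (succ_missed fr kD bP).
have := mu_le eS mub; rewrite lee_fin ler_pdivrMr ?ltr0n // lerBlDr => h.
have {}h : ((7 * k)%N%:R <= ((\max_(v in S) deg v) * 5 + 6)%N%:R :> R)%R.
  by rewrite natrD !natrM.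
by move: h; rewrite ler_nat; lia.
Qed.

Theorem theorem1p7 (R : realFieldType) (k : nat) (G : sgraph) :
  2 <= k ->
  tough (1 : R)%R G ->
  kconnected k G ->
  induced_free (P2_kP1 k) G ->
  (((7 * k%:R - 6) / 5)%R%:E <= mu R k.+1 G)%E ->
  hamiltonian G \/ iso G petersen.
Proof.
move=> k2 tG kG fr mub.
have [ham|[n [P [x [bP xmax]]]]] := base_or_hamiltonian k2 kG fr; first by left.
have kD := kconnected_deg kG x; right.
have bound := base_mu_bound fr bP kD xmax mub; have lc := base_lcycle bP.
have [/existsP[i st]|] := boolP [exists i : 'I_n, star_succ n x P (Posz i)]; last first.
  rewrite negb_exists => /forallP nst; exfalso.
  apply: (no_star_absurd fr (ltnW k2) kD bP _ tG) => z.
  have [w hw E] := lcycle_reprP lc z 0%R.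
  have wn : `|w|%N < n by have := lcycle_gt2 lc; clear -hw; lia.
  have := nst (Ordinal wn); rewrite /= (_ : Posz `|w| = w); last by clear -hw; lia.
  by rewrite /star_succ E; have := E 0%R; rewrite !addr0 => ->.
have [c1 _] := star_lower_bounds fr bP st.
have [kltD|kgeD] := ltnP k (deg x).
  have noalt z : adj x (P z) -> star_pred n x P (z - 1)%R -> ~~ star_succ n x P (z + 1)%R.
    move=> az sp; apply/negP => ss; have := deg_alternation fr bP kltD az sp ss.
    by clear -bound kltD k2; lia.
  have := deg_no_alternation fr bP st noalt.
  by clear -bound kltD k2; lia.
have c2 : cnt (star_succ n x P) 0%R (Posz n) <= deg x.
  have e := cnt_nbr bP (0 - 1)%R.
  rewrite -e (_ : (0 - 1 + Posz n = Posz n + -1)%R); last by clear; lia.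
  rewrite -(cnt_shift (fun w => adj x (P w))); apply: cnt_le => // z _ _.
  by case/andP.
(* With [deg x = k], [c1] gives three starred successors, so [deg x >= 3], and [bound] gives
   [k <= 3]. *)
have [k3 D3] : k = 3 /\ deg x = 3 by clear -bound kgeD kD k2 c1 c2; lia.
rewrite k3 in fr kG; apply: (cycle_petersen fr bP D3 _ _ st).
  by move=> v /xmax; rewrite D3.
by move=> v; apply: kconnected_deg kG v.
Qed.
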